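(* Let $H$ be a Hopf algebra over a field $k$ with antipode $S$, and let $A$ be a finite dimensional right $H$-comodule algebra. The following assertions are equivalent. (1) $A$ is left $H$-Frobenius. (2) There exists a non-degenerate associative bilinear form $B:A\times A\to k$ such that $B(b,(h^*S^2)\cdot a)=B((h^*S)\cdot b,a)$ for any $a,b\in A$ and any $h^*\in H^*$. (3) $A$ has a hyperplane $\mathcal{H}$ which does not contain any non-zero left ideal of $A$, and $(h^*S^2)\cdot A\subseteq \mathcal{H}$ for any $h^*\in H^*$ with $h^*(1)=0$. (4) $A$ has a hyperplane $\mathcal{H}$ which does not contain any non-zero subobject of $A^{(S^2)}$ in ${}_{A^{(S^2)}}\mathcal{M}^H$, and $(h^*S^2)\cdot A\subseteq \mathcal{H}$ for any $h^*\in H^*$ with $h^*(1)=0$. (5) $A^{(S^2)}$ is a Frobenius algebra in the monoidal category $\mathcal{M}^H$.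
   Context: All algebras and coalgebras are over the field $k$; the antipode $S$ is not assumed bijective. $\mathcal{M}^H$ is the monoidal category of right $H$-comodules. A right $H$-comodule algebra is an algebra in $\mathcal{M}^H$, with coaction $a\mapsto\sum a_0\otimes a_1$ that is an algebra map $A\to A\otimes H$. The associated left action of $H^*=\mathrm{Hom}(H,k)$ on $A$ is $h^*\cdot a=\sum h^*(a_1)a_0$; $h^*S$ and $h^*S^2$ denote the compositions $h^*\circ S$ and $h^*\circ S\circ S$. A hyperplane is a linear subspace of codimension 1. A bilinear form $B$ is associative if $B(xy,z)=B(x,yz)$ for all $x,y,z\in A$. $A^{(S^2)}$ denotes the right $H$-comodule algebra which equals $A$ as an algebra and has coaction $a\mapsto\sum a_0\otimes S^2(a_1)$. For a right $H$-comodule algebra $R$, ${}_R\mathcal{M}^H$ is the category of left $(R,H)$-Doi-Hopf modules: left $R$-modules $M$ that are right $H$-comodules with $\rho(rm)=\sum r_0m_0\otimes r_1m_1$; morphisms are $R$-linear $H$-colinear maps. The dual space $A^*$ is a right $H$-comodule with coaction $f\mapsto\sum f_{0}\otimes f_{1}$ determined by $\sum f_{0}(x)f_{1}=\sum f(x_0)S(x_1)$ for all $x\in A$. Together with the left action $(af)(x)=f(xa)$, $A^*$ is an object of ${}_{A^{(S^2)}}\mathcal{M}^H$. $A$ is called left $H$-Frobenius if $A^{(S^2)}\simeq A^*$ in ${}_{A^{(S^2)}}\mathcal{M}^H$. An algebra $R$ in $\mathcal{M}^H$ is a Frobenius algebra in $\mathcal{M}^H$ if there is a coalgebra structure $(R,\delta,\varepsilon_R)$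 in $\mathcal{M}^H$ (i.e. $\delta:R\to R\otimes R$ and $\varepsilon_R:R\to k$ are $H$-colinear, coassociative and counital) such that $\delta$ is a morphism of $R,R$-bimodules. *)

(* Defs.v *)
From HB Require Import structures.
From mathcomp Require Import all_boot all_order all_algebra falgebra.
From mathcomp Require Import boolp.

Set Implicit Arguments.
Unset Strict Implicit.
Unset Printing Implicit Defensive.

Import GRing.Theory.
Local Open Scope ring_scope.
Local Open Scope quotient_scope.

Definition islin (k : fieldType) (U V : lmodType k) (f : U -> V) : Prop :=
  forall a u v, f (a *: u + v) = a *: f u + f v.

Definition bilin (k : fieldType) (U V W : lmodType k) (f : U -> V -> W) : Prop :=
  (forall v, islin (f^~ v)) /\ (forall u, islin (f u)).

(* MathComp has no tensor product of possibly infinite dimensional spaces.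
   [tensor U V] is the free commutative monoid on U * V (finite sequences up to
   permutation) modulo the congruence generated by the bilinearity relations;
   its universal property is [tliftE], [islin_tlift] and [tensor_ext] below. *)
Inductive tens_eq (k : fieldType) (U V : lmodType k) :
    seq (U * V) -> seq (U * V) -> Prop :=
| tens_refl s : tens_eq s s
| tens_sym s t : tens_eq s t -> tens_eq t s
| tens_trans s t r : tens_eq s t -> tens_eq t r -> tens_eq s r
| tens_cat s s' t t' : tens_eq s s' -> tens_eq t t' ->
    tens_eq (s ++ t) (s' ++ t')
| tens_catC s t : tens_eq (s ++ t) (t ++ s)
| tens_0l v : tens_eq [:: (0, v)] [::]
| tens_Dl u u' v : tens_eq [:: (u + u', v)] [:: (u, v); (u', v)]
| tens_Dr u v v' : tens_eq [:: (u, v + v')] [:: (u, v); (u, v')]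
| tens_Z a u v : tens_eq [:: (a *: u, v)] [:: (u, a *: v)].

Section TensorDef.
Variables (k : fieldType) (U V : lmodType k).

Implicit Types (s : seq (U * V)).

Definition tens_eqb (s t : seq (U * V)) : bool := `[< tens_eq s t >].

Lemma tens_eqb_refl : reflexive tens_eqb.
Proof. by move=> s; apply/asboolP; constructor. Qed.
Lemma tens_eqb_sym : symmetric tens_eqb.
Proof. by move=> s t; apply/asboolP/asboolP => h; apply: tens_sym. Qed.
Lemma tens_eqb_trans : transitive tens_eqb.
Proof.
by move=> s t r /asboolP h /asboolP h'; apply/asboolP; apply: tens_trans h h'.
Qed.
Canonical tens_equiv :=
  EquivRel tens_eqb tens_eqb_refl tens_eqb_sym tens_eqb_trans.

Definition tensor := {eq_quot tens_equiv}.

HB.instance Definition _ := Choice.copy tensor {eq_quot tens_equiv}.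

Definition tcl (s : seq (U * V)) : tensor := \pi_tensor s.

Lemma tclP s t : tcl s = tcl t <-> tens_eq s t.
Proof.
split; first by move=> /eqmodP /asboolP.
by move=> h; apply/eqmodP/asboolP.
Qed.

Lemma tcl_repr t : tcl (repr t) = t. Proof. exact: reprK. Qed.

Definition tadd (x y : tensor) : tensor := tcl (repr x ++ repr y).
Definition tzero : tensor := tcl [::].
Definition tscale (a : k) (x : tensor) : tensor :=
  tcl [seq (a *: p.1, p.2) | p <- repr x].
Definition topp (x : tensor) : tensor := tscale (-1) x.

Lemma taddE s t : tadd (tcl s) (tcl t) = tcl (s ++ t).
Proof.
apply/tclP; apply: tens_cat; apply/tclP; exact: tcl_repr.
Qed.

Lemma tens_map a s (t : seq (U * V)) : tens_eq s t ->
  tens_eq [seq (a *: p.1, p.2) | p <- s] [seq (a *: p.1, p.2) | p <- t].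
Proof.
elim=> {s t} /=; try by constructor.
- by move=> s t r _ h1 _ h2; apply: tens_trans h1 h2.
- by move=> s s' t t' _ h1 _ h2; rewrite !map_cat; apply: tens_cat.
- by move=> s t; rewrite !map_cat; apply: tens_catC.
- by move=> v; rewrite scaler0; constructor.
- by move=> u u' v; rewrite scalerDr; constructor.
- move=> b u v; apply: (@tens_trans _ _ _ _ [:: (b *: (a *: u), v)]).
    by rewrite !scalerA mulrC; constructor.
  by constructor.
Qed.

Lemma tscaleE a s : tscale a (tcl s) = tcl [seq (a *: p.1, p.2) | p <- s].
Proof. by apply/tclP/tens_map/tclP/tcl_repr. Qed.

Lemma tensP (P : tensor -> Prop) : (forall s, P (tcl s)) -> forall t, P t.
Proof. by move=> h t; rewrite -(tcl_repr t). Qed.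

Lemma taddA : associative tadd.
Proof.
by elim/tensP=> x; elim/tensP=> y; elim/tensP=> z; rewrite !taddE catA.
Qed.
Lemma taddC : commutative tadd.
Proof.
by elim/tensP=> x; elim/tensP=> y; rewrite !taddE; apply/tclP; constructor.
Qed.
Lemma tadd0 : left_id tzero tadd.
Proof. by elim/tensP=> x; rewrite taddE. Qed.

Lemma tscaleDl x a b : tscale (a + b) x = tadd (tscale a x) (tscale b x).
Proof.
elim/tensP: x => s; rewrite !tscaleE taddE; apply/tclP.
elim: s => [|[u v] s IH] /=; first by constructor.
rewrite scalerDl -cat1s.
have h := tens_cat (tens_Dl (a *: u) (b *: u) v) IH.
apply: (tens_trans h) => /=.
rewrite -cat1s -[X in tens_eq _ X]cat1s; apply: tens_cat; first by constructor.
by rewrite -cat1s catA -[X in tens_eq _ (_ ++ X)]cat1s catA; apply: tens_cat;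
  constructor.
Qed.
Lemma tscale0 x : tscale 0 x = tzero.
Proof.
elim/tensP: x => s; rewrite !tscaleE; apply/tclP.
elim: s => [|[u v] s IH] /=; first by constructor.
by rewrite scale0r -cat1s -[X in tens_eq _ X]cat0s; apply: tens_cat => //;
  constructor.
Qed.
Lemma tscale1 : left_id 1 tscale.
Proof.
elim/tensP=> s; rewrite tscaleE; congr tcl.
by rewrite -[RHS]map_id; apply: eq_map => -[u v] /=; rewrite scale1r.
Qed.
Lemma tscaleDr : right_distributive tscale tadd.
Proof.
by move=> a; elim/tensP=> x; elim/tensP=> y; rewrite !(taddE, tscaleE) map_cat.
Qed.
Lemma tscaleA a b x : tscale a (tscale b x) = tscale (a * b) x.
Proof.
elim/tensP: x => s; rewrite !tscaleE -map_comp; congr tcl.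
by apply: eq_map => -[u v] /=; rewrite scalerA.
Qed.
Lemma taddN : left_inverse tzero topp tadd.
Proof.
by move=> x; rewrite -{2}[x]tscale1 /topp -tscaleDl addNr tscale0.
Qed.

HB.instance Definition _ := GRing.isZmodule.Build tensor taddA taddC tadd0 taddN.
HB.instance Definition _ := GRing.Zmodule_isLmodule.Build k tensor
  tscaleA tscale1 tscaleDr tscaleDl.

Definition tens (u : U) (v : V) : tensor := tcl [:: (u, v)].

(* The linear map induced by f; only meaningful for bilinear f. *)
Definition tlift (W : lmodType k) (f : U -> V -> W) (t : tensor) : W :=
  \sum_(p <- repr t) f p.1 p.2.
End TensorDef.

Notation "u \ot v" := (tens u v) (at level 40, left associativity) : ring_scope.

(* Sweedler notation: if t = sum_i u_i \ot v_i, this is sum_i E(u_i, v_i). *)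
Notation "'\sw_' ( x , y <- t ) E" := (tlift (fun x y => E) t)
  (at level 41, E at level 41, t at level 35, x name, y name,
   format "'[' '\sw_' ( x ,  y  <-  t ) '/  '  E ']'") : ring_scope.

Section TensorTheory.
Variables (k : fieldType) (U V W : lmodType k).
Implicit Types (t : tensor U V) (f g : U -> V -> W).

Lemma tens_sum t : t = \sum_(p <- repr t) p.1 \ot p.2.
Proof.
rewrite -{1}[t]tcl_repr; elim: (repr t) => [|[u v] s IH]; first by rewrite big_nil.
by rewrite big_cons -IH -cat1s -taddE.
Qed.

Lemma islin0 (X Y : lmodType k) (f : X -> Y) : islin f -> f 0 = 0.
Proof.
by move=> h; have := h (-1) 0 0; rewrite !scaleN1r oppr0 add0r addNr.
Qed.
Lemma islinD (X Y : lmodType k) (f : X -> Y) x y :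
  islin f -> f (x + y) = f x + f y.
Proof. by move=> h; have := h 1 x y; rewrite !scale1r. Qed.
Lemma islinZ (X Y : lmodType k) (f : X -> Y) a x :
  islin f -> f (a *: x) = a *: f x.
Proof. by move=> h; have := h a x 0; rewrite (islin0 h) !addr0. Qed.
Lemma islin_sum (X Y : lmodType k) (f : X -> Y) I (s : seq I) (F : I -> X) :
  islin f -> f (\sum_(i <- s) F i) = \sum_(i <- s) f (F i).
Proof.
move=> h; elim: s => [|i s IH]; first by rewrite !big_nil islin0.
by rewrite !big_cons islinD // IH.
Qed.

Lemma tlift_cl f s : bilin f -> tlift f (tcl s) = \sum_(p <- s) f p.1 p.2.
Proof.
move=> [h1 h2]; rewrite /tlift.
have /tclP := tcl_repr (tcl s); move: (repr _) => r; elim=> {r s} //.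
- by move=> s1 s2 r _ -> _ ->.
- by move=> s1 s' t t' _ h _ h'; rewrite !big_cat /= h h'.
- by move=> s1 t; rewrite !big_cat /= addrC.
- by move=> v; rewrite big_cons !big_nil addr0 /= (islin0 (h1 v)).
- by move=> u u' v; rewrite !big_cons !big_nil !addr0 /= (islinD _ _ (h1 v)).
- by move=> u v v'; rewrite !big_cons !big_nil !addr0 /= (islinD _ _ (h2 u)).
- by move=> a u v;
    rewrite !big_cons !big_nil !addr0 /= (islinZ _ _ (h1 v)) (islinZ _ _ (h2 u)).
Qed.

Lemma tliftE f u v : bilin f -> tlift f (u \ot v) = f u v.
Proof. by move=> h; rewrite tlift_cl // big_cons big_nil addr0. Qed.

Lemma islin_tlift f : bilin f -> islin (tlift f).
Proof.
move=> h a; elim/tensP=> x; elim/tensP=> y.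
have -> : a *: tcl x + tcl y = tcl ([seq (a *: p.1, p.2) | p <- x] ++ y).
  by rewrite -taddE -tscaleE.
rewrite !tlift_cl // big_cat /= big_map scaler_sumr; congr (_ + _).
by apply: eq_bigr => p _ /=; rewrite (islinZ _ _ (h.1 p.2)).
Qed.

Lemma tensor_ext (f g : tensor U V -> W) : islin f -> islin g ->
  (forall u v, f (u \ot v) = g (u \ot v)) -> f =1 g.
Proof.
move=> hf hg h t; rewrite (tens_sum t) !islin_sum //.
by apply: eq_bigr => p _; rewrite h.
Qed.

Lemma eq_tlift f g t : (forall u v, f u v = g u v) -> tlift f t = tlift g t.
Proof. by move=> h; apply: eq_bigr => p _; rewrite h. Qed.

Lemma bilin_tens : bilin (@tens k U V).
Proof.
split=> [v|u] a x y; rewrite /tens.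
  have -> : a *: tcl [:: (x, v)] + tcl [:: (y, v)] = tcl [:: (a *: x, v); (y, v)].
    by rewrite -[RHS]/(tcl ([:: (a *: x, v)] ++ [:: (y, v)])) -taddE
      -[a *: _]/(tscale a _) tscaleE.
  by apply/tclP; constructor.
have -> : a *: tcl [:: (u, x)] + tcl [:: (u, y)] = tcl [:: (a *: u, x); (u, y)].
  by rewrite -[RHS]/(tcl ([:: (a *: u, x)] ++ [:: (u, y)])) -taddE
    -[a *: _]/(tscale a _) tscaleE.
apply/tclP; apply: tens_trans (tens_Dr _ _ _) _.
by rewrite -cat1s -[X in tens_eq _ X]cat1s; apply: tens_cat;
  [apply: tens_sym|]; constructor.
Qed.

End TensorTheory.

Lemma tlift_tens (k : fieldType) (U V : lmodType k) (t : tensor U V) :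
  \sw_(u, v <- t) (u \ot v) = t.
Proof. by rewrite [RHS]tens_sum. Qed.

Section IsLin.
Variable k : fieldType.
Implicit Types X Y Z W : lmodType k.

Lemma islin_id X : islin (fun x : X => x). Proof. by []. Qed.
Lemma islin_linear X Y (f : {linear X -> Y}) : islin (fun x => f x).
Proof. by move=> a u v; rewrite linearP. Qed.
Lemma islin_scalar X (f : {scalar X}) : islin (fun x => (f x : k^o)).
Proof. by move=> a u v; rewrite linearP. Qed.
Lemma islin_clin X Y Z (f : {linear Y -> Z}) (g : X -> Y) :
  islin g -> islin (fun x => f (g x)).
Proof. by move=> hg a u v; rewrite hg linearP. Qed.
Lemma islin_cscal X Y (f : {scalar Y}) (g : X -> Y) :
  islin g -> islin (fun x => (f (g x) : k^o)).
Proof. by move=> hg a u v; rewrite hg linearP. Qed.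
Lemma islin_hom (X : lmodType k) (Y Z : vectType k) (f : 'Hom(Y, Z)) (g : X -> Y) :
  islin g -> islin (fun x => f (g x)).
Proof. by move=> hg a u v; rewrite hg linearP. Qed.
Lemma islin_ev (X : lmodType k) (Y Z : vectType k) (g : X -> 'Hom(Y, Z)) (y : Y) :
  islin g -> islin (fun x => g x y).
Proof. by move=> hg a u v; rewrite hg add_lfunE scale_lfunE. Qed.
Lemma islin_comp X Y Z (f : Y -> Z) (g : X -> Y) :
  islin (fun y => f y) -> islin g -> islin (fun x => f (g x)).
Proof. by move=> hf hg a u v; rewrite hg hf. Qed.
Lemma islin_tensl X Y Z (g : X -> Y) (z : Z) :
  islin g -> islin (fun x => g x \ot z).
Proof. by move=> hg a u v; rewrite hg; apply: (bilin_tens _ _).1. Qed.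
Lemma islin_tensr X Y Z (g : X -> Y) (z : Z) :
  islin g -> islin (fun x => z \ot g x).
Proof. by move=> hg a u v; rewrite hg; apply: (bilin_tens _ _).2. Qed.
Lemma islin_mull X (A : algType k) (g : X -> A) (b : A) :
  islin g -> islin (fun x => g x * b).
Proof. by move=> hg a u v; rewrite hg mulrDl scalerAl. Qed.
Lemma islin_mulr X (A : algType k) (g : X -> A) (b : A) :
  islin g -> islin (fun x => b * g x).
Proof. by move=> hg a u v; rewrite hg mulrDr scalerAr. Qed.
Lemma islin_scalel X Y (g : X -> k^o) (y : Y) :
  islin g -> islin (fun x => g x *: y).
Proof. by move=> hg a u v; rewrite hg scalerDl -scalerA. Qed.
Lemma islin_scaler X Y (g : X -> Y) (c : k) :
  islin g -> islin (fun x => c *: g x).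
Proof. by move=> hg a u v; rewrite hg scalerDr !scalerA mulrC. Qed.
Lemma islin_kmull X (g : X -> k^o) (c : k) :
  islin g -> islin (fun x => (g x * c : k^o)).
Proof. by move=> hg a u v; rewrite hg mulrDl -[a *: _]/(a * _) -mulrA. Qed.
Lemma islin_tliftf X (U V : lmodType k) W (f : X -> U -> V -> W) t :
  (forall u v, islin (fun x => f x u v)) -> islin (fun x => tlift (f x) t).
Proof.
move=> h a x y; rewrite /tlift scaler_sumr -big_split /=.
by apply: eq_bigr => p _; rewrite h.
Qed.
Lemma islin_tliftt X (U V : lmodType k) W (f : U -> V -> W) (g : X -> tensor U V) :
  bilin f -> islin g -> islin (fun x => tlift f (g x)).
Proof. by move=> h hg a x y; rewrite hg islin_tlift. Qed.

Lemma tlift_comp (U V X Y : lmodType k) (f : X -> Y) (g : U -> V -> X) t :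
  islin f -> f (tlift g t) = tlift (fun u v => f (g u v)) t.
Proof. by move=> h; rewrite /tlift islin_sum. Qed.

Lemma tlift_exch (U V U' V' X : lmodType k) (g : U -> V -> U' -> V' -> X) t t' :
  \sw_(u, v <- t) \sw_(u', v' <- t') g u v u' v' =
  \sw_(u', v' <- t') \sw_(u, v <- t) g u v u' v'.
Proof. by rewrite /tlift exchange_big. Qed.
End IsLin.

(* Proves linearity of expressions built from the operations above. *)
Ltac lin_step := match goal with
  | |- islin (fun x => @?g x \ot ?v) => apply: (@islin_tensl _ _ _ _ g v)
  | |- islin (fun x => ?v \ot @?g x) => apply: (@islin_tensr _ _ _ _ g v)
  | |- islin (fun x => tlift ?f (@?g x)) => apply: (@islin_tliftt _ _ _ _ _ f g)
  | |- islin (fun x => tlift (@?f x) ?t) => apply: (@islin_tliftf _ _ _ _ _ f t)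
  | |- islin (fun x => GRing.mul (@?g x) ?b) => apply: (@islin_mull _ _ _ g b)
  | |- islin (fun x => GRing.mul (@?g x) ?b) => apply: (@islin_kmull _ _ g b)
  | |- islin (fun x => GRing.mul ?b (@?g x)) => apply: (@islin_mulr _ _ _ g b)
  | |- islin (fun x => GRing.scale (@?g x) ?b) => apply: (@islin_scalel _ _ _ g b)
  | |- islin (fun x => GRing.scale ?b (@?g x)) => apply: (@islin_scaler _ _ _ g b)
  | |- islin (fun x => GRing.Linear.sort ?f (@?g x)) =>
      apply: (@islin_clin _ _ _ _ f g)
  | |- islin (fun x => GRing.Linear.sort ?f (@?g x)) =>
      apply: (@islin_cscal _ _ _ f g)
  | |- islin (fun x => fun_of_lfun ?f (@?g x)) => apply: (@islin_hom _ _ _ _ f g)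
  | |- islin (fun x => fun_of_lfun (@?g x) ?y) => apply: (@islin_ev _ _ _ _ g y)
  | |- islin (GRing.Linear.sort ?f) => exact: islin_linear
  | |- islin (fun x => ?f (@?g x)) =>
      apply: (@islin_comp _ _ _ _ f g); first (first [assumption | exact: islin_linear])
  end.
Ltac lin := cbv beta; lazymatch goal with
  | |- bilin _ => split; intro; lin
  | |- forall _, _ => intro; lin
  | |- islin (fun x => x) => apply: islin_id
  | |- islin _ => first [assumption | lin_step; lin]
  end.

Definition trilin (k : fieldType) (U V X W : lmodType k)
    (F : U -> V -> X -> W) : Prop :=
  [/\ forall v x, islin (fun u => F u v x), forall u x, islin (fun v => F u v x)
    & forall u v, islin (fun x => F u v x)].

Section Push.
Variables (k : fieldType) (U V X Y Z : lmodType k) (t : tensor U V).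

Lemma tlift_tlift (f : X -> Y -> Z) (g : U -> V -> tensor X Y) : bilin f ->
  tlift f (\sw_(u, v <- t) g u v) = \sw_(u, v <- t) tlift f (g u v).
Proof. by move=> h; apply: tlift_comp; apply: islin_tlift. Qed.
Lemma tlift_tensl (g : U -> V -> X) (y : Y) :
  (\sw_(u, v <- t) g u v) \ot y = \sw_(u, v <- t) (g u v \ot y).
Proof. by apply: (tlift_comp (f := fun x => x \ot y)); lin. Qed.
Lemma tlift_tensr (g : U -> V -> X) (y : Y) :
  y \ot (\sw_(u, v <- t) g u v) = \sw_(u, v <- t) (y \ot g u v).
Proof. by apply: (tlift_comp (f := fun x => y \ot x)); lin. Qed.
Lemma tlift_lin (f : {linear X -> Y}) (g : U -> V -> X) :
  f (\sw_(u, v <- t) g u v) = \sw_(u, v <- t) f (g u v).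
Proof. by apply: (tlift_comp (f := fun x => f x)); lin. Qed.
Lemma tlift_scaler (c : k) (g : U -> V -> X) :
  c *: (\sw_(u, v <- t) g u v) = \sw_(u, v <- t) (c *: g u v).
Proof. by apply: (tlift_comp (f := fun x => c *: x)); lin. Qed.
Lemma tlift_mull (A : algType k) (g : U -> V -> A) (y : A) :
  (\sw_(u, v <- t) g u v) * y = \sw_(u, v <- t) (g u v * y).
Proof. by apply: (tlift_comp (f := fun x => x * y)); lin. Qed.
Lemma tlift_mulr (A : algType k) (g : U -> V -> A) (y : A) :
  y * (\sw_(u, v <- t) g u v) = \sw_(u, v <- t) (y * g u v).
Proof. by apply: (tlift_comp (f := fun x => y * x)); lin. Qed.
Lemma scale_tensl (c : k) (x : X) (y : Y) : (c *: x) \ot y = c *: (x \ot y).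
Proof. by apply: (@islinZ _ _ _ (fun x => x \ot y)); lin. Qed.
Lemma scale_tensr (c : k) (x : X) (y : Y) : x \ot (c *: y) = c *: (x \ot y).
Proof. by apply: (@islinZ _ _ _ (fun y => x \ot y)); lin. Qed.
End Push.

Section TMul.
Variables (k : fieldType) (A B : algType k).

(* Multiplication of the algebra A \ot B; its unit is 1 \ot 1. *)
Definition tmul (s t : tensor A B) : tensor A B :=
  \sw_(a, b <- s) \sw_(c, d <- t) ((a * c) \ot (b * d)).

Lemma bilin_tmul : bilin tmul.
Proof. by rewrite /tmul; lin. Qed.
Lemma tmulE a b c d : tmul (a \ot b) (c \ot d) = (a * c) \ot (b * d).
Proof. by rewrite /tmul tliftE; [rewrite tliftE; last lin|lin]. Qed.
Lemma tmul1t t : tmul (1 \ot 1) t = t.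
Proof.
rewrite /tmul tliftE; last lin; rewrite -[RHS]tlift_tens.
by apply: eq_tlift => u v; rewrite !mul1r.
Qed.
Lemma tmult1 t : tmul t (1 \ot 1) = t.
Proof.
rewrite /tmul -[RHS]tlift_tens.
by apply: eq_tlift => u v; rewrite tliftE ?mulr1 //; last lin.
Qed.
Lemma tmulA x y z : tmul x (tmul y z) = tmul (tmul x y) z.
Proof.
have l s : islin (tmul s) by apply: (bilin_tmul).2.
have r s : islin (tmul^~ s) by apply: (bilin_tmul).1.
have r' f s : islin f -> islin (fun x => tmul (f x) s).
  by move=> h; apply: islin_comp h; apply: r.
have l' f s : islin f -> islin (fun x => tmul s (f x)).
  by move=> h; apply: islin_comp h; apply: l.
move: x; apply: tensor_ext; [exact: r|exact: r'|] => a b.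
move: y; apply: tensor_ext; [apply: l'; exact: r|apply: r'; exact: l|] => c d.
move: z; apply: tensor_ext; [apply: l'; exact: l|exact: l|] => e f.
by rewrite !tmulE !mulrA.
Qed.
End TMul.

(* Coassociativity is (D \ot id) o D = (id \ot D) o D, read in C \ot (C \ot C). *)
Record coalgebra_axioms (k : fieldType) (C : lmodType k)
    (D : C -> tensor C C) (eps : C -> k) : Prop := CoalgebraAxioms {
  coassoc : forall c, \sw_(x, y <- D c) \sw_(x1, x2 <- D x) (x1 \ot (x2 \ot y))
                      = \sw_(x, y <- D c) (x \ot D y);
  counitl : forall c, \sw_(x, y <- D c) (eps x *: y) = c;
  counitr : forall c, \sw_(x, y <- D c) (eps y *: x) = c
}.

Record hopfAlg (k : fieldType) (H : algType k) := HopfAlg {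
  comul : {linear H -> tensor H H};
  counit : {scalar H};
  antipode : {linear H -> H};
  hopf_coalg : coalgebra_axioms comul counit;
  comulM : forall x y, comul (x * y) = tmul (comul x) (comul y);
  comul1 : comul 1 = 1 \ot 1;
  counitM : forall x y, counit (x * y) = counit x * counit y;
  counit1 : counit 1 = 1;
  antipodel : forall h, \sw_(x, y <- comul h) (antipode x * y) = counit h *: 1;
  antipoder : forall h, \sw_(x, y <- comul h) (x * antipode y) = counit h *: 1
}.

(* Right H-comodule structures on M, i.e. objects of M^H with underlying space M. *)
Record comodule (k : fieldType) (H : algType k) (hH : hopfAlg H)
    (M : lmodType k) := Comodule {
  coact :> {linear M -> tensor M H};
  coactA : forall m,
    \sw_(m0, m1 <- coact m) \sw_(m00, m01 <- coact m0) (m00 \ot (m01 \ot m1))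
    = \sw_(m0, m1 <- coact m) (m0 \ot comul hH m1);
  coact1 : forall m, \sw_(m0, m1 <- coact m) (counit hH m1 *: m0) = m
}.

Definition colinear (k : fieldType) (H : algType k) (hH : hopfAlg H)
    (M N : lmodType k) (X : comodule hH M) (Y : comodule hH N)
    (f : M -> N) : Prop :=
  forall m, Y (f m) = \sw_(m0, m1 <- X m) (f m0 \ot m1).

(* Coassociativity applied to an arbitrary trilinear expression. *)
Lemma sw_assoc (k : fieldType) (M C D W : lmodType k) (r : M -> tensor M C)
  (d : C -> tensor C C) (F : M -> C -> C -> W) m :
  trilin F ->
  \sw_(x, y <- r m) \sw_(x1, x2 <- r x) (x1 \ot (x2 \ot y))
    = \sw_(x, y <- r m) (x \ot d y) ->
  islin r -> islin d ->
  \sw_(x, y <- r m) \sw_(x1, x2 <- r x) F x1 x2 y =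
  \sw_(x, y <- r m) \sw_(y1, y2 <- d y) F x y1 y2.
Proof.
move=> [h1 h2 h3] e hr hd.
have b x : bilin (F x) by split=> ?; [apply: h2|apply: h3].
have B : bilin (fun x t => \sw_(y1, y2 <- t) F x y1 y2).
  by split=> [t|x]; [apply: islin_tliftf => ? ?; apply: h1|apply: islin_tlift].
have := congr1 (tlift (fun x t => \sw_(y1, y2 <- t) F x y1 y2)) e.
rewrite !tlift_tlift // => E.
transitivity (\sw_(x, y <- r m) tlift (fun x t => \sw_(y1, y2 <- t) F x y1 y2)
  (\sw_(x1, x2 <- r x) (x1 \ot (x2 \ot y)))).
  apply: eq_tlift => x y; rewrite tlift_tlift //; apply: eq_tlift => x1 x2.
  by rewrite !tliftE.
by rewrite E; apply: eq_tlift => x y; rewrite tliftE.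
Qed.

Ltac trilin := split; move=> ? ?; lin.

Section Hopf.
Variables (k : fieldType) (H : algType k) (hH : hopfAlg H).
Notation D := (comul hH).
Notation eps := (counit hH).
Notation S := (antipode hH).

Lemma comod_sw (M W : lmodType k) (X : comodule hH M) (F : M -> H -> H -> W) m :
  trilin F ->
  \sw_(x, y <- X m) \sw_(x1, x2 <- X x) F x1 x2 y =
  \sw_(x, y <- X m) \sw_(y1, y2 <- D y) F x y1 y2.
Proof.
move=> h; apply: (@sw_assoc k M H H W) => //; first exact: coactA.
all: exact: islin_linear.
Qed.

Lemma comul_sw (W : lmodType k) (F : H -> H -> H -> W) h :
  trilin F ->
  \sw_(x, y <- D h) \sw_(x1, x2 <- D x) F x1 x2 y =
  \sw_(x, y <- D h) \sw_(y1, y2 <- D y) F x y1 y2.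
Proof.
move=> t; apply: (@sw_assoc k H H H W) => //; first exact: coassoc (hopf_coalg hH) h.
all: exact: islin_linear.
Qed.

Lemma swl (W : lmodType k) (F : H -> W) h : islin F ->
  \sw_(x, y <- D h) (eps x *: F y) = F h.
Proof.
move=> hF; rewrite -[in RHS](counitl (hopf_coalg hH) h) (tlift_comp _ _ hF).
by apply: eq_tlift => x y; rewrite (islinZ _ _ hF).
Qed.
Lemma swr (W : lmodType k) (F : H -> W) h : islin F ->
  \sw_(x, y <- D h) (eps y *: F x) = F h.
Proof.
move=> hF; rewrite -[in RHS](counitr (hopf_coalg hH) h) (tlift_comp _ _ hF).
by apply: eq_tlift => x y; rewrite (islinZ _ _ hF).
Qed.
Lemma comod_swr (M W : lmodType k) (X : comodule hH M) (F : M -> W) m :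
  islin F -> \sw_(x, y <- X m) (eps y *: F x) = F m.
Proof.
move=> hF; rewrite -[in RHS](coact1 X m) (tlift_comp _ _ hF).
by apply: eq_tlift => x y; rewrite (islinZ _ _ hF).
Qed.

Lemma antipode1 : S 1 = 1.
Proof.
have := antipodel hH 1; rewrite comul1 tliftE; last lin.
by rewrite mulr1 counit1 scale1r.
Qed.

Lemma counit_antipode h : eps (S h) = eps h.
Proof.
have := congr1 eps (antipodel hH h).
rewrite linearZ /= counit1 mulr1 => <-.
rewrite -[h in LHS](counitr (hopf_coalg hH) h) tlift_lin.
rewrite (tlift_comp (f := fun x => (eps x : k^o))); last lin.
rewrite (tlift_comp (f := fun x => (eps x : k^o))); last lin.
by apply: (@eq_tlift _ _ _ k^o) => x y; rewrite counitM !linearZ /= mulrC.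
Qed.

Lemma antipodeM x y : S (x * y) = S y * S x.
Proof.
pose T := \sw_(x1, x' <- D x) \sw_(y1, y' <- D y)
  \sw_(x2, x3 <- D x') \sw_(y2, y3 <- D y')
    (S (x1 * y1) * ((x2 * y2) * (S y3 * S x3))).
have -> : S (x * y) = T.
  transitivity (\sw_(x1, x' <- D x) (eps x' *: \sw_(y1, y' <- D y)
      (eps y' *: S (x1 * y1)))).
    by rewrite swr; last lin; rewrite swr; last lin.
  apply: eq_tlift => x1 x'; rewrite tlift_scaler.
  apply: eq_tlift => y1 y'.
  transitivity (\sw_(x2, x3 <- D x') (S (x1 * y1) * (x2 * (eps y' *: 1) * S x3))).
    rewrite -(tlift_comp (f := fun z => S (x1 * y1) * z)); last lin.
    transitivity (S (x1 * y1) * (eps y' *: \sw_(x2, x3 <- D x') (x2 * S x3))).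
      by rewrite antipoder -!scalerAr mulr1 !scalerA mulrC.
    rewrite tlift_scaler; congr (_ * _); apply: eq_tlift => a b.
    by rewrite -scalerAr -scalerAl mulr1.
  apply: eq_tlift => x2 x3; rewrite -antipoder tlift_mulr tlift_mull tlift_mulr.
  by apply: eq_tlift => y2 y3; rewrite !mulrA.
transitivity (\sw_(x', x3 <- D x) \sw_(y', y3 <- D y)
  \sw_(x1, x2 <- D x') \sw_(y1, y2 <- D y')
    (S (x1 * y1) * ((x2 * y2) * (S y3 * S x3)))).
  transitivity (\sw_(x1, x' <- D x) \sw_(x2, x3 <- D x')
    \sw_(y1, y' <- D y) \sw_(y2, y3 <- D y')
      (S (x1 * y1) * ((x2 * y2) * (S y3 * S x3)))).
    by apply: eq_tlift => x1 x'; rewrite tlift_exch.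
  rewrite -(@comul_sw _ (fun x1 x2 x3 => \sw_(y1, y' <- D y) \sw_(y2, y3 <- D y')
      (S (x1 * y1) * ((x2 * y2) * (S y3 * S x3))))); last trilin.
  apply: eq_tlift => x' x3; rewrite [RHS]tlift_exch.
  apply: eq_tlift => x1 x2.
  by rewrite -(@comul_sw _ (fun y1 y2 y3 =>
      (S (x1 * y1) * ((x2 * y2) * (S y3 * S x3))))); last trilin.
transitivity (\sw_(x', x3 <- D x) (eps x' *: \sw_(y', y3 <- D y)
     (eps y' *: (S y3 * S x3)))); last first.
  by rewrite swl; last lin; rewrite swl; last lin.
apply: eq_tlift => x' x3; rewrite tlift_scaler.
apply: eq_tlift => y' y3.
rewrite scalerA -counitM -[S y3 * _ in RHS]mul1r scalerAl -antipodel comulM.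
rewrite /tmul tlift_tlift; last lin.
rewrite tlift_mull; apply: eq_tlift => a b.
rewrite tlift_tlift; last lin.
rewrite tlift_mull; apply: eq_tlift => c d.
rewrite tliftE; last lin.
by rewrite !mulrA.
Qed.

Lemma conv_uniq (B : lmodType k) (mu : B -> B -> B) (e : B) (f g h : H -> B) :
  bilin mu -> associative mu -> left_id e mu -> right_id e mu ->
  islin f -> islin g -> islin h ->
  (forall c, \sw_(x, y <- D c) mu (f x) (g y) = eps c *: e) ->
  (forall c, \sw_(x, y <- D c) mu (g x) (h y) = eps c *: e) -> f =1 h.
Proof.
move=> [ml mr] muA mu1 mu1' hf hg hh fg gh c.
have Ml z (F : H -> B) : islin F -> islin (fun x => mu (F x) z).
  by move=> hF; apply: (islin_comp (f := mu^~ z) (ml z) hF).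
have Mr z (F : H -> B) : islin F -> islin (fun x => mu z (F x)).
  by move=> hF; apply: (islin_comp (f := mu z) (mr z) hF).
transitivity (\sw_(x, y <- D c) \sw_(y1, y2 <- D y) mu (f x) (mu (g y1) (h y2))).
  rewrite -(swr c hf); apply: eq_tlift => x y.
  rewrite -(tlift_comp (f := mu (f x))); last exact: mr.
  by rewrite gh (islinZ _ _ (mr _)) mu1'.
rewrite -(@comul_sw _ (fun x y z => mu (f x) (mu (g y) (h z)))); last first.
  by split=> *; [apply: Ml|apply/Mr/Ml|apply/Mr/Mr].
rewrite -[RHS](swl c hh); apply: eq_tlift => x y.
transitivity (\sw_(x1, x2 <- D x) mu (mu (f x1) (g x2)) (h y)).
  by apply: eq_tlift => *; rewrite muA.
rewrite -(tlift_comp (f := fun z => mu z (h y))); last exact: ml.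
by rewrite fg (islinZ _ _ (ml _)) mu1.
Qed.

Lemma comul_antipode h : D (S h) = \sw_(x, y <- D h) (S y \ot S x).
Proof.
apply: (@conv_uniq _ (@tmul k H H) (1 \ot 1) (fun h => D (S h)) D
  (fun h => \sw_(x, y <- D h) (S y \ot S x))); try lin.
- exact: bilin_tmul.
- exact: tmulA.
- exact: tmul1t.
- exact: tmult1.
- move=> c; rewrite -(comul1 hH) -linearZ /= -antipodel tlift_lin.
  by apply: eq_tlift => x y; rewrite comulM.
move=> c.
transitivity (\sw_(x, y <- D c) \sw_(p, q <- D x) \sw_(a, b <- D y)
    ((p * S b) \ot (q * S a))).
  apply: eq_tlift => x y; rewrite /tmul; apply: eq_tlift => p q.
  rewrite tlift_tlift; last lin.
  by apply: eq_tlift => a b; rewrite tliftE; last lin.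
rewrite (@comul_sw _ (fun p q y => \sw_(a, b <- D y) ((p * S b) \ot (q * S a))));
  last trilin.
transitivity (\sw_(p, y <- D c) ((p * S y) \ot 1 : tensor H H)).
  apply: eq_tlift => p y.
  rewrite -(@comul_sw _ (fun q a b => ((p * S b) \ot (q * S a)))); last trilin.
  rewrite -(@swl _ (fun y => (p * S y) \ot 1)); last lin.
  apply: eq_tlift => w b.
  by rewrite -tlift_tensr antipoder scale_tensr.
by rewrite -tlift_tensl antipoder scale_tensl.
Qed.
End Hopf.

(* Right H-comodule algebra structures on A. *)
Record comodAlg (k : fieldType) (H : algType k) (hH : hopfAlg H)
    (A : algType k) := ComodAlg {
  ca_comodule :> comodule hH A;
  ca_mul : forall a b, ca_comodule (a * b) = tmul (ca_comodule a) (ca_comodule b);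
  ca_one : ca_comodule 1 = 1 \ot 1
}.

(* Objects of the category of left (R, H)-Doi-Hopf modules, with underlying
   space M. *)
Record doiHopf (k : fieldType) (H : algType k) (hH : hopfAlg H)
    (R : algType k) (rR : comodAlg hH R) (M : lmodType k) := DoiHopf {
  dh_comodule :> comodule hH M;
  dh_act : R -> M -> M;
  dh_act_bilin : bilin dh_act;
  dh_act1 : forall m, dh_act 1 m = m;
  dh_actM : forall r s m, dh_act (r * s) m = dh_act r (dh_act s m);
  dh_compat : forall r m, dh_comodule (dh_act r m) =
    \sw_(r0, r1 <- rR r) \sw_(m0, m1 <- dh_comodule m) (dh_act r0 m0 \ot (r1 * m1))
}.

Section DoiHopfTheory.
Variables (k : fieldType) (H : algType k) (hH : hopfAlg H).
Variables (R : algType k) (rR : comodAlg hH R).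

Definition dh_hom (M N : lmodType k) (X : doiHopf rR M) (Y : doiHopf rR N)
    (f : {linear M -> N}) : Prop :=
  (forall r m, f (dh_act X r m) = dh_act Y r (f m)) /\ colinear X Y f.

Definition dh_iso (M N : lmodType k) (X : doiHopf rR M) (Y : doiHopf rR N) : Prop :=
  exists (f : {linear M -> N}) (g : {linear N -> M}),
    [/\ dh_hom X Y f, dh_hom Y X g, cancel f g & cancel g f].

(* W is (the underlying space of) a subobject of X: a submodule which is also a
   subcomodule, i.e. the coaction maps W into the image of W \ot H in M \ot H. *)
Definition dh_subobject (M : vectType k) (X : doiHopf rR M) (W : {vspace M}) : Prop :=
  (forall r w, w \in W -> dh_act X r w \in W) /\
  (forall w, w \in W -> exists t : tensor (subvs_of W) H,
     X w = \sw_(u, h <- t) (vsval u \ot h)).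

Lemma reg_act_bilin : bilin (fun r x : R => r * x).
Proof. by lin. Qed.

(* R itself, as a Doi-Hopf module over R. *)
Definition dh_regular : doiHopf rR R :=
  @DoiHopf _ _ _ _ rR _ (rR : comodule hH R) (fun r x => r * x) reg_act_bilin
    (@mul1r _) (fun r s m => esym (mulrA r s m)) (ca_mul rR).

End DoiHopfTheory.

(* The left action of h^* in H^*: the sum of h^*(a_1) a_0. *)
Definition hact (k : fieldType) (H : algType k) (hH : hopfAlg H) (M : lmodType k)
    (X : comodule hH M) (f : H -> k) (a : M) : M :=
  \sw_(a0, a1 <- X a) (f a1 *: a0).

Section Constructions.
Variables (k : fieldType) (H : algType k) (hH : hopfAlg H).
Notation D := (comul hH).
Notation eps := (counit hH).
Notation S := (antipode hH).

Lemma comul_antipode2 h : D (S (S h)) = \sw_(x, y <- D h) (S (S x) \ot S (S y)).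
Proof.
rewrite comul_antipode comul_antipode tlift_tlift; last lin.
by apply: eq_tlift => x y; rewrite tliftE; last lin.
Qed.

Section Twist.
Variables (M : lmodType k) (X : comodule hH M).

Definition twist_coact (a : M) : tensor M H := \sw_(a0, a1 <- X a) (a0 \ot S (S a1)).

Fact twist_coact_linear : linear twist_coact.
Proof. by have : islin twist_coact by rewrite /twist_coact; lin. Qed.
HB.instance Definition _ :=
  GRing.isLinear.Build k M (tensor M H) *:%R twist_coact twist_coact_linear.

Fact twist_coactA m :
  \sw_(m0, m1 <- twist_coact m) \sw_(m00, m01 <- twist_coact m0)
     (m00 \ot (m01 \ot m1))
  = \sw_(m0, m1 <- twist_coact m) (m0 \ot D m1).
Proof.
rewrite /twist_coact !tlift_tlift; try lin.
transitivity (\sw_(x, y <- X m) \sw_(x0, x1 <- X x)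
   (x0 \ot (S (S x1) \ot S (S y)))).
  apply: eq_tlift => x y; rewrite tliftE; last lin.
  rewrite tlift_tlift; last lin.
  by apply: eq_tlift => x0 x1; rewrite tliftE; last lin.
rewrite (@comod_sw _ _ _ _ _ _ (fun x y z => x \ot (S (S y) \ot S (S z))));
  last trilin.
apply: eq_tlift => x y; rewrite tliftE; last lin.
by rewrite comul_antipode2 tlift_tensr.
Qed.

Fact twist_coact1 m : \sw_(m0, m1 <- twist_coact m) (eps m1 *: m0) = m.
Proof.
rewrite /twist_coact tlift_tlift; last lin.
rewrite -[RHS](coact1 X); apply: eq_tlift => x y.
by rewrite tliftE; [rewrite !counit_antipode|lin].
Qed.

(* The comodule obtained from X by corestriction along S^2. *)
Definition twist_comodule : comodule hH M :=
  @Comodule _ _ hH M twist_coact twist_coactA twist_coact1.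
End Twist.

Section TwistAlg.
Variables (A : algType k) (rA : comodAlg hH A).

Fact twist_mul a b : twist_comodule rA (a * b) =
  tmul (twist_comodule rA a) (twist_comodule rA b).
Proof.
rewrite /= /twist_coact ca_mul /tmul !tlift_tlift; try lin.
apply: eq_tlift => x y; rewrite tlift_tlift; last lin.
rewrite tliftE; last lin.
rewrite tlift_tlift; last lin.
apply: eq_tlift => u v; rewrite !tliftE; try lin.
by rewrite !antipodeM.
Qed.

Fact twist_one : twist_comodule rA 1 = 1 \ot 1.
Proof. by rewrite /= /twist_coact ca_one tliftE ?antipode1 //; lin. Qed.

(* The comodule algebra A^(S^2). *)
Definition twist : comodAlg hH A :=
  @ComodAlg _ _ hH A (twist_comodule rA) twist_mul twist_one.
End TwistAlg.

Section Tensor.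
Variables (M N : lmodType k) (X : comodule hH M) (Y : comodule hH N).

Definition tensor_coact (t : tensor M N) : tensor (tensor M N) H :=
  \sw_(m, n <- t) \sw_(m0, m1 <- X m) \sw_(n0, n1 <- Y n)
    ((m0 \ot n0) \ot (m1 * n1)).

Fact tensor_coact_linear : linear tensor_coact.
Proof. by have : islin tensor_coact by rewrite /tensor_coact; lin. Qed.
HB.instance Definition _ :=
  GRing.isLinear.Build k (tensor M N) (tensor (tensor M N) H) *:%R
    tensor_coact tensor_coact_linear.

Lemma tensor_coactE m n : tensor_coact (m \ot n) =
  \sw_(m0, m1 <- X m) \sw_(n0, n1 <- Y n) ((m0 \ot n0) \ot (m1 * n1)).
Proof. by rewrite /tensor_coact tliftE; last lin. Qed.

Fact tensor_coactA t :
  \sw_(m0, m1 <- tensor_coact t) \sw_(m00, m01 <- tensor_coact m0)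
     (m00 \ot (m01 \ot m1))
  = \sw_(m0, m1 <- tensor_coact t) (m0 \ot D m1).
Proof.
move: t; apply: tensor_ext; try lin.
move=> m n; rewrite tensor_coactE !tlift_tlift; try lin.
transitivity (\sw_(m', m2 <- X m) \sw_(m0, m1 <- X m') \sw_(n', n2 <- Y n)
   \sw_(n0, n1 <- Y n') ((m0 \ot n0) \ot ((m1 * n1) \ot (m2 * n2)))).
  apply: eq_tlift => m' m2; rewrite tlift_tlift; last lin.
  rewrite tlift_exch; apply: eq_tlift => n' n2.
  rewrite tliftE; last lin.
  rewrite tensor_coactE tlift_tlift; last lin.
  apply: eq_tlift => m0 m1; rewrite tlift_tlift; last lin.
  by apply: eq_tlift => n0 n1; rewrite tliftE; last lin.
rewrite (@comod_sw _ _ _ _ _ _ (fun m0 m1 m2 => \sw_(n', n2 <- Y n)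
   \sw_(n0, n1 <- Y n') ((m0 \ot n0) \ot ((m1 * n1) \ot (m2 * n2)))));
  last trilin.
apply: eq_tlift => m0 m'; rewrite tlift_tlift; last lin.
transitivity (\sw_(m1, m2 <- D m') \sw_(n0, n' <- Y n) \sw_(n1, n2 <- D n')
  ((m0 \ot n0) \ot ((m1 * n1) \ot (m2 * n2)))).
  apply: eq_tlift => m1 m2.
  by rewrite (@comod_sw _ _ _ _ _ _ (fun n0 n1 n2 =>
    ((m0 \ot n0) \ot ((m1 * n1) \ot (m2 * n2))))); last trilin.
rewrite tlift_exch; apply: eq_tlift => n0 n'.
rewrite tliftE; last lin.
rewrite comulM /tmul tlift_tensr; apply: eq_tlift => m1 m2.
by rewrite tlift_tensr.
Qed.

Fact tensor_coact1 t : \sw_(m0, m1 <- tensor_coact t) (eps m1 *: m0) = t.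
Proof.
move: t; apply: tensor_ext; try lin.
move=> m n; rewrite tensor_coactE !tlift_tlift; try lin.
transitivity (\sw_(m0, m1 <- X m) (eps m1 *: \sw_(n0, n1 <- Y n)
   (eps n1 *: (m0 \ot n0)))).
  apply: eq_tlift => m0 m1; rewrite tlift_tlift ?tlift_scaler; last lin.
  apply: eq_tlift => n0 n1; rewrite tliftE; last lin.
  by rewrite counitM scalerA.
rewrite comod_swr; last lin.
by rewrite (comod_swr (F := fun n0 => m \ot n0) Y n); last lin.
Qed.

(* The tensor product of M^H, with the codiagonal coaction. *)
Definition tensor_comodule : comodule hH (tensor M N) :=
  @Comodule _ _ hH _ tensor_coact tensor_coactA tensor_coact1.
End Tensor.

Definition unit_coact (c : k^o) : tensor k^o H := c \ot 1.
Fact unit_coact_linear : linear unit_coact.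
Proof. by have : islin unit_coact by rewrite /unit_coact; lin. Qed.
HB.instance Definition _ :=
  GRing.isLinear.Build k k^o (tensor k^o H) *:%R unit_coact unit_coact_linear.
Fact unit_coactA m :
  \sw_(m0, m1 <- unit_coact m) \sw_(m00, m01 <- unit_coact m0)
     (m00 \ot (m01 \ot m1))
  = \sw_(m0, m1 <- unit_coact m) (m0 \ot D m1).
Proof.
rewrite /unit_coact tliftE; last lin.
rewrite tliftE; last lin.
rewrite tliftE; last lin.
by rewrite comul1.
Qed.
Fact unit_coact1 m : \sw_(m0, m1 <- unit_coact m) (eps m1 *: m0) = m.
Proof.
by rewrite /unit_coact tliftE; [rewrite counit1 scale1r|lin].
Qed.

(* The unit object of M^H. *)
Definition unit_comodule : comodule hH k^o :=
  @Comodule _ _ hH _ unit_coact unit_coactA unit_coact1.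

Section Frobenius.
Variables (R : algType k) (rR : comodAlg hH R).

Definition frobenius_in_comod : Prop :=
  exists (delta : {linear R -> tensor R R}) (epsR : {linear R -> k^o}),
    [/\ coalgebra_axioms delta epsR,
        colinear rR (tensor_comodule rR rR) delta,
        colinear rR unit_comodule epsR,
        forall a b, delta (a * b) = \sw_(x, y <- delta b) ((a * x) \ot y)
      & forall a b, delta (a * b) = \sw_(x, y <- delta a) (x \ot (y * b))].
End Frobenius.

End Constructions.

Section DualTensor.
Variables (k : fieldType) (A : vectType k).
Local Notation e := (vbasis {:A}).

(* If t = sum_i f_i \ot w_i in A^* \ot W, this is sum_i f_i(x) w_i. *)
Definition dual_eval (W : lmodType k) (x : A) (t : tensor 'Hom(A, k^o) W) : W :=
  tlift (fun (f : 'Hom(A, k^o)) w => (f x : k) *: w) t.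

Definition dual_basis (i : 'I_(\dim {:A})) : 'Hom(A, k^o) :=
  linfun (coord e i : A -> k^o).

Lemma bilin_dual_eval (W : lmodType k) x :
  bilin (fun (f : 'Hom(A, k^o)) (w : W) => (f x : k) *: w).
Proof. by lin. Qed.
Lemma islin_dual_eval (W : lmodType k) x : islin (@dual_eval W x).
Proof. exact/islin_tlift/bilin_dual_eval. Qed.
Lemma dual_evalE (W : lmodType k) x f (w : W) :
  dual_eval x (f \ot w) = (f x : k) *: w.
Proof. exact/tliftE/bilin_dual_eval. Qed.

Lemma dual_basis_expand (f : 'Hom(A, k^o)) :
  f = \sum_(i < \dim {:A}) (f e`_i : k) *: dual_basis i.
Proof.
apply/lfunP => x; rewrite {1}(coord_vbasis (memvf x)) sum_lfunE linear_sum.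
by apply: eq_bigr => i _;
  rewrite linearZ /= scale_lfunE lfunE /= -[LHS]/(_ * _) mulrC.
Qed.

Lemma dual_eval_basis (W : lmodType k) (F : 'I_(\dim {:A}) -> W) x :
  dual_eval x (\sum_(i < \dim {:A}) dual_basis i \ot F i)
  = \sum_(i < \dim {:A}) coord e i x *: F i.
Proof.
rewrite (islin_sum _ _ (islin_dual_eval x)); apply: eq_bigr => i _.
by rewrite dual_evalE lfunE.
Qed.

Lemma dual_tensor_expand (W : lmodType k) (t : tensor 'Hom(A, k^o) W) :
  t = \sum_(i < \dim {:A}) dual_basis i \ot dual_eval e`_i t.
Proof.
move: t; apply: tensor_ext => [//||f w].
  move=> a u v; rewrite scaler_sumr -big_split; apply: eq_bigr => i _ /=.
  by rewrite (islin_dual_eval _) (bilin_tens _ _).2.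
rewrite {1}(dual_basis_expand f) (islin_sum (f := fun z => z \ot w)); last lin.
by apply: eq_bigr => i _; rewrite dual_evalE scale_tensl scale_tensr.
Qed.

Lemma dual_tensor_ext (W : lmodType k) (s t : tensor 'Hom(A, k^o) W) :
  (forall x, dual_eval x s = dual_eval x t) -> s = t.
Proof.
move=> h; rewrite (dual_tensor_expand s) (dual_tensor_expand t).
by apply: eq_bigr => i _; rewrite h.
Qed.
End DualTensor.

Section Dual.
Variables (k : fieldType) (H : algType k) (hH : hopfAlg H).
Notation D := (comul hH).
Notation eps := (counit hH).
Notation S := (antipode hH).
Variables (A : falgType k) (rA : comodAlg hH A).
Implicit Types f : 'Hom(A, k^o).
Local Notation e := (vbasis {:A}).

(* The coaction f |-> sum f_0 \ot f_1 of A^*, in coordinates; see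
   [dual_coactE] and [dual_coact_unique] for the characterization
   sum f_0(x) f_1 = sum f(x_0) S(x_1). *)
Definition dual_coact (f : 'Hom(A, k^o)) : tensor 'Hom(A, k^o) H :=
  \sum_(i < \dim {:A})
    dual_basis i \ot \sw_(a0, a1 <- rA e`_i) ((f a0 : k) *: S a1).

Lemma dual_coactE f x :
  dual_eval x (dual_coact f) = \sw_(x0, x1 <- rA x) ((f x0 : k) *: S x1).
Proof.
rewrite dual_eval_basis {2}(coord_vbasis (memvf x)).
have h : islin (fun x => \sw_(x0, x1 <- rA x) ((f x0 : k) *: S x1)) by lin.
by rewrite (islin_sum _ _ h); apply: eq_bigr => i _; rewrite (islinZ _ _ h).
Qed.

Lemma dual_coact_unique f (t : tensor 'Hom(A, k^o) H) :
  (forall x, dual_eval x t = \sw_(x0, x1 <- rA x) ((f x0 : k) *: S x1)) ->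
  t = dual_coact f.
Proof. by move=> h; apply: dual_tensor_ext => x; rewrite h dual_coactE. Qed.

Fact dual_coact_linear : linear dual_coact.
Proof.
have h : islin dual_coact; last by [].
move=> a f g; symmetry; apply: dual_coact_unique => x.
rewrite (islin_dual_eval x) !dual_coactE.
have h : islin (fun f : 'Hom(A, k^o) =>
  \sw_(x0, x1 <- rA x) ((f x0 : k) *: S x1)) by lin.
by rewrite h.
Qed.
HB.instance Definition _ := GRing.isLinear.Build k 'Hom(A, k^o)
  (tensor 'Hom(A, k^o) H) *:%R dual_coact dual_coact_linear.

Fact dual_coactA f :
  \sw_(f0, f1 <- dual_coact f) \sw_(f00, f01 <- dual_coact f0)
     (f00 \ot (f01 \ot f1))
  = \sw_(f0, f1 <- dual_coact f) (f0 \ot D f1).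
Proof.
apply: dual_tensor_ext => x.
rewrite !(tlift_comp _ _ (islin_dual_eval x)).
transitivity (\sw_(x0, x1 <- rA x) (S x1 \ot dual_eval x0 (dual_coact f))).
  transitivity (\sw_(f0, f1 <- dual_coact f) (dual_eval x (dual_coact f0) \ot f1)).
    apply: eq_tlift => f0 f1.
    rewrite (tlift_comp _ _ (islin_dual_eval x)).
    rewrite {2}/dual_eval tlift_tensl; apply: eq_tlift => f00 f01.
    by rewrite dual_evalE scale_tensl.
  transitivity (\sw_(f0, f1 <- dual_coact f) \sw_(x0, x1 <- rA x)
     (S x1 \ot (((f0 : 'Hom(A, k^o)) x0 : k) *: f1))).
    apply: eq_tlift => f0 f1; rewrite dual_coactE tlift_tensl.
    by apply: eq_tlift => x0 x1; rewrite scale_tensl scale_tensr.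
  by rewrite tlift_exch; apply: eq_tlift => x0 x1; rewrite tlift_tensr.
transitivity (D (dual_eval x (dual_coact f))); last first.
  rewrite /dual_eval tlift_lin; apply: eq_tlift => f0 f1.
  by rewrite [RHS]dual_evalE linearZ.
rewrite dual_coactE tlift_lin.
transitivity (\sw_(x0, x1 <- rA x) \sw_(y, z <- D x1)
  ((f x0 : k) *: (S z \ot S y))).
  rewrite -(@comod_sw _ _ _ _ _ _ (fun x0 y z => (f x0 : k) *: (S z \ot S y)));
    last trilin.
  apply: eq_tlift => x0 x1; rewrite dual_coactE tlift_tensr.
  by apply: eq_tlift => y z; rewrite scale_tensr.
by apply: eq_tlift => x0 x1; rewrite linearZ /= comul_antipode tlift_scaler.
Qed.

Fact dual_coact1 f : \sw_(f0, f1 <- dual_coact f) (eps f1 *: f0) = f.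
Proof.
apply/lfunP => x.
rewrite (tlift_comp (f := fun g : 'Hom(A, k^o) => g x)); last lin.
transitivity (eps (dual_eval x (dual_coact f)) : k^o).
  rewrite /dual_eval (tlift_comp (f := fun z => (eps z : k^o))); last lin.
  by apply: (@eq_tlift _ _ _ k^o) => f0 f1;
    rewrite scale_lfunE linearZ /= -[LHS]/(_ * _) mulrC.
rewrite dual_coactE (tlift_comp (f := fun z => (eps z : k^o))); last lin.
rewrite -[in RHS](coact1 rA x) tlift_lin; apply: (@eq_tlift _ _ _ k^o) => x0 x1.
by rewrite !linearZ /= counit_antipode mulrC.
Qed.

Definition dual_comodule : comodule hH 'Hom(A, k^o) :=
  @Comodule _ _ hH _ dual_coact dual_coactA dual_coact1.

(* (a f)(x) = f (x a) *)
Definition dual_act (a : A) (f : 'Hom(A, k^o)) : 'Hom(A, k^o) :=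
  (f \o amulr a)%VF.

Lemma dual_actE a f x : dual_act a f x = f (x * a).
Proof. by rewrite /dual_act comp_lfunE lfunE. Qed.

Fact dual_act_bilin : bilin dual_act.
Proof.
split=> [f|a] c u v; apply/lfunP => x; rewrite add_lfunE scale_lfunE !dual_actE.
  by rewrite mulrDr -scalerAr linearP.
by rewrite add_lfunE scale_lfunE.
Qed.
Fact dual_act1 f : dual_act 1 f = f.
Proof. by apply/lfunP => x; rewrite dual_actE mulr1. Qed.
Fact dual_actM a b f : dual_act (a * b) f = dual_act a (dual_act b f).
Proof. by apply/lfunP => x; rewrite !dual_actE mulrA. Qed.

Fact dual_compat a f : dual_comodule (dual_act a f) =
  \sw_(a0, a1 <- twist rA a) \sw_(f0, f1 <- dual_comodule f)
    (dual_act a0 f0 \ot (a1 * f1)).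
Proof.
have L (b : A) (X : lmodType k) (g : X -> 'Hom(A, k^o)) : islin g ->
    islin (fun x => dual_act b (g x)).
  by move=> h; apply: (islin_comp (f := dual_act b)) h; apply: dual_act_bilin.2.
have L' (g' : 'Hom(A, k^o)) (X : lmodType k) (g : X -> A) : islin g ->
    islin (fun x => dual_act (g x) g').
  by move=> h; apply: (islin_comp (f := dual_act^~ g')) h; apply: dual_act_bilin.1.
apply: dual_tensor_ext => x; rewrite dual_coactE /= /twist_coact.
rewrite tlift_tlift; last first.
  by split=> ?; apply: islin_tliftf => ? ?; [apply: islin_tensl; apply: L'|];
    lin.
rewrite (tlift_comp _ _ (islin_dual_eval x)).
transitivity (\sw_(a0, a1 <- rA a) (S (S a1) *
  \sw_(x0, x1 <- rA (x * a0)) ((f x0 : k) *: S x1))); last first.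
  apply: eq_tlift => a0 a1; rewrite tliftE; last first.
    by split=> ?; apply: islin_tliftf => ? ?; [apply: islin_tensl; apply: L'|];
      lin.
  rewrite -dual_coactE /dual_eval tlift_mulr [RHS](tlift_comp _ _ (islin_dual_eval x)).
  by apply: eq_tlift => f0 f1; rewrite dual_evalE dual_actE scalerAr.
transitivity (\sw_(x0, x1 <- rA x) ((f (x0 * a) : k) *: S x1)).
  by apply: eq_tlift => x0 x1; rewrite dual_actE.
transitivity (\sw_(x0, x1 <- rA x) \sw_(a', a2 <- rA a) \sw_(a0, a1 <- rA a')
    ((f (x0 * a0) : k) *: (S (S a2) * S a1 * S x1))); last first.
  rewrite tlift_exch; apply: eq_tlift => a' a2.
  rewrite ca_mul /tmul tlift_tlift; last lin.
  rewrite tlift_mulr; apply: eq_tlift => x0 x1.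
  rewrite tlift_tlift; last lin.
  rewrite tlift_mulr; apply: eq_tlift => a0 a1.
  by rewrite tliftE; [rewrite antipodeM -scalerAr mulrA|lin].
apply: eq_tlift => x0 x1.
rewrite (@comod_sw _ _ _ _ _ _ (fun a0 a1 a2 =>
    (f (x0 * a0) : k) *: (S (S a2) * S a1 * S x1))); last trilin.
rewrite -(comod_swr (F := fun a0 => (f (x0 * a0) : k) *: S x1) rA a); last lin.
apply: eq_tlift => a0 a'.
rewrite -tlift_scaler -tlift_mull.
transitivity (eps a' *: ((f (x0 * a0) : k) *: (S 1 * S x1))).
  by rewrite antipode1 mul1r.
rewrite !scalerA mulrC -scalerA scalerAl -linearZ /= -antipoder tlift_lin.
congr (_ *: (_ * _)); apply: eq_tlift => y z; exact: antipodeM.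
Qed.

(* A^*, as an object of the category of Doi-Hopf modules over A^(S^2). *)
Definition dual_doiHopf : doiHopf (twist rA) 'Hom(A, k^o) :=
  @DoiHopf _ _ _ _ (twist rA) _ dual_comodule dual_act dual_act_bilin
    dual_act1 dual_actM dual_compat.

Definition left_H_Frobenius : Prop :=
  dh_iso (dh_regular (twist rA)) dual_doiHopf.
End Dual.

Definition nondegenerate_form (k : fieldType) (A : vectType k)
    (B : {biscalar A}) : Prop :=
  (forall x, (forall y, B x y = 0) -> x = 0) /\
  (forall y, (forall x, B x y = 0) -> y = 0).

Definition associative_form (k : fieldType) (A : algType k)
    (B : {biscalar A}) : Prop :=
  forall x y z, B (x * y) z = B x (y * z).

Definition hyperplane (k : fieldType) (A : vectType k) (P : {vspace A}) : Prop :=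
  (\dim P).+1 = \dim {:A}.

(* An additive subgroup stable under left multiplication by A is automatically a
   linear subspace, so left ideals are subspaces without loss of generality. *)
Definition left_ideal (k : fieldType) (A : falgType k) (I : {vspace A}) : Prop :=
  forall a x, x \in I -> a * x \in I.

(* Main.v *)
Require Import Defs.
From HB Require Import structures.
From mathcomp Require Import all_boot all_order all_algebra falgebra.
From mathcomp Require Import boolp classical_sets.

(** Everything is encoded in a single linear functional lam on A, such that

    - sum lam(a_0) S^2(a_1) = lam(a) 1 for all a, that is, lam is a colinear map
      from A^(S^2) to the unit object;
    - no nonzero a satisfies lam(x a) = 0 for all x.

    Call it a Frobenius functional.  A morphism from the free module A^(S^2) to
    A^* sends a to the functional x |-> lam(x a), where lam is the image of 1;
    associative forms are B(x, y) = lam(x y); hyperplanes are kernels of nonzero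
    lam; and in a Frobenius algebra lam is the counit.  Getting a form from an
    isomorphism, and a hyperplane from a form, is a direct translation along this
    dictionary.  The circle is closed by extracting a Frobenius functional from
    the hyperplane condition on subobjects and from a Frobenius algebra
    structure, and by building from it such a structure and an isomorphism from
    A^(S^2) to A^*.

    The one computation that uses the Hopf structure seriously is
    [twist_coinvariant_transpose]: colinearity of lam forces
    sum lam(x a_0) S^2(a_1) = sum lam(x_0 a) S(x_1).  This says that the whole
    map a |-> lam(- a) is colinear from A^(S^2) to A^*.  Cancelling the factor
    S^2(x_1) does not require an inverse of S, because
    S(x_2) S^2(x_1) = S(S(x_1) x_2) is already a counit.

    For a hyperplane, the condition on the functionals h with h(1) = 0 says that
    no such h separates sum lam(a_0) S^2(a_1) from the line k 1; H may have infinite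
    dimension, so Zorn's lemma is needed to have enough functionals
    ([separating_functional]).  Then the kernel of a |-> lam(- a), the largest
    left ideal in the hyperplane, is the kernel of a morphism of Doi-Hopf
    modules, hence a subobject ([annihilator_subobject]), hence zero.

    A Frobenius functional gives dual bases e_i, f_i of A, and the Frobenius
    comultiplication is a |-> sum_i a e_i (x) f_i.  All identities about the
    Casimir element sum_i e_i (x) f_i, including its coinvariance, are checked
    after applying lam(y -) to the left tensor factor, which loses no
    information by [frob_tensor_ext].  Conversely the counit of a Frobenius
    algebra is a Frobenius functional since a = sum lam(y a) x, where
    sum x (x) y is the image of 1 under the comultiplication. *)

Set Implicit Arguments.
Unset Strict Implicit.
Unset Printing Implicit Defensive.

Import GRing.Theory.
Local Open Scope ring_scope.

(** * Separating a vector from a subspace *)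

Definition subspace (k : fieldType) (V : lmodType k) (Q : V -> Prop) : Prop :=
  Q 0 /\ forall a u v, Q u -> Q v -> Q (a *: u + v).

Section Separation.
Variables (k : fieldType) (V : lmodType k).
Implicit Types (Q M : V -> Prop) (h : V).

(** Zorn's lemma.  By maximality, adding any x outside M to M captures h: this
    is the last conclusion, which makes M a complement of the line of h. *)
Lemma maximal_avoiding Q h : subspace Q -> ~ Q h ->
  exists M : V -> Prop, [/\ subspace M, forall v, Q v -> M v, ~ M h
    & forall x, ~ M x -> exists a, M (h - a *: x)].
Proof.
move=> [Q0 QP] nQh.
(* The empty chain must have an admissible union, so the condition is put on
   X together with Q, not on X itself. *)
pose P (X : set V) := subspace (fun v => X v \/ Q v) /\ ~ X h.
have [F FP tF|X [[[X0 XP] nXh] Xmax]] := @Zorn_bigcup V P.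
  split=> [|[X FX Xh]]; last by have [_] := FP _ FX; apply.
  split=> [|a u v]; first by right.
  move=> [[X FX Xu]|Qu] [[Y FY Yv]|Qv].
  - have [XY|YX] := tF X Y FX FY.
      have [[_ H] _] := FP _ FY.
      by have [Y'|] := H a u v (or_introl (XY _ Xu)) (or_introl Yv);
        [left; exists Y|right].
    have [[_ H] _] := FP _ FX.
    by have [X'|] := H a u v (or_introl Xu) (or_introl (YX _ Yv));
      [left; exists X|right].
  - have [[_ H] _] := FP _ FX.
    by have [X'|] := H a u v (or_introl Xu) (or_intror Qv);
      [left; exists X|right].
  - have [[_ H] _] := FP _ FY.
    by have [Y'|] := H a u v (or_intror Qu) (or_introl Yv);
      [left; exists Y|right].
  - by right; apply: QP.
pose M v := X v \/ Q v.
exists M; split=> //; [by move=> v; right|by case|].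
move=> x nMx; apply: contrapT => nh.
pose Y v := exists a, M (v - a *: x).
have MY v : M v -> Y v by move=> Mv; exists 0; rewrite scale0r subr0.
apply: (Xmax Y); last first.
  split=> //; split=> [|a u v]; first by left; exact: MY.
  have YP : forall z, Y z \/ Q z -> Y z by move=> z [//|Qz]; apply: MY; right.
  move=> /YP[b Mb] /YP[c Mc]; left; exists (a * b + c).
  have -> : a *: u + v - (a * b + c) *: x = a *: (u - b *: x) + (v - c *: x).
    by rewrite scalerDl scalerBr scalerA opprD addrACA.
  exact: XP.
split=> [v Xv|YX]; first by apply: MY; left.
apply: nMx; left; apply: YX.
by exists 1; rewrite scale1r subrr.
Qed.

(** The coordinate along h with respect to the decomposition of V into the line
    of h and a maximal subspace M containing Q but not h. *)
Lemma separating_functional Q h : subspace Q -> ~ Q h ->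
  exists f : {scalar V}, (forall v, Q v -> f v = 0) /\ f h = 1.
Proof.
move=> sQ nQh; have [M [[M0 MP] QM nMh Mmax]] := maximal_avoiding sQ nQh.
have MZ a v : M v -> M (a *: v).
  by move=> Mv; rewrite -[_ *: _]addr0; apply: MP.
have exc v : exists c, M (v - c *: h).
  have [Mv|/Mmax[a Mh]] := pselect (M v).
    by exists 0; rewrite scale0r subr0.
  have [a0|a0] := eqVneq a 0; first by move: Mh; rewrite a0 scale0r subr0.
  exists a^-1.
  have -> : v - a^-1 *: h = - a^-1 *: (h - a *: v).
    by rewrite scalerBr scalerA mulNr mulVf // scaleN1r opprK scaleNr addrC.
  exact: MZ.
pose f v : k := sval (cid (exc v)).
have fP v : M (v - f v *: h) by rewrite /f; case: cid.
have fu v c : M (v - c *: h) -> f v = c.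
  move=> Mc; apply: contrapT => /eqP; rewrite -subr_eq0 => nfc; apply: nMh.
  have -> : h = (f v - c)^-1 *: (-1 *: (v - f v *: h) + (v - c *: h)).
    rewrite scaleN1r opprB addrA subrK -scalerBl scalerA mulVf ?scale1r //.
  by apply: MZ; apply: MP.
have f_lin : linear_for *%R f.
  move=> a u v; apply: fu.
  have -> : a *: u + v - (a * f u + f v) *: h =
      a *: (u - f u *: h) + (v - f v *: h).
    by rewrite scalerDl scalerBr scalerA opprD addrACA.
  by apply: MP.
pose fL := GRing.isLinear.Build k V k *%R f f_lin.
pose g : {scalar V} := HB.pack f fL.
exists g; split=> [v /QM Mv|]; apply: fu.
  by rewrite scale0r subr0.
by rewrite scale1r subrr.
Qed.
End Separation.

(** * Frobenius functionals *)

Section LeftFrobenius.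
Variables (k : fieldType) (H : algType k) (hH : hopfAlg H).
Variables (A : falgType k) (rA : comodAlg hH A).
Local Notation D := (comul hH).
Local Notation eps := (counit hH).
Local Notation S := (antipode hH).
Implicit Types (lam : {linear A -> k^o}) (a b x y : A).

Definition twist_coinvariant lam : Prop :=
  forall a, \sw_(a0, a1 <- rA a) ((lam a0 : k) *: S (S a1)) = (lam a : k) *: 1.

Definition left_faithful lam : Prop :=
  forall a, (forall x, lam (x * a) = 0) -> a = 0.

(** A tensor over k^o \ot H is the same as an element of H; the map
    c \ot z |-> c z translates between the two formulations. *)
Lemma twist_coinvariantP lam :
  twist_coinvariant lam <-> colinear (twist rA) (unit_comodule hH) lam.
Proof.
split=> [h a|h a].
  rewrite /= /twist_coact tlift_tlift; last lin.
  transitivity ((1 : k^o) \ot ((lam a : k) *: (1 : H))).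
    by rewrite scale_tensr -scale_tensl /unit_coact;
      congr (_ \ot _); exact/esym/mulr1.
  rewrite -h tlift_tensr; apply: eq_tlift => a0 a1.
  rewrite tliftE; last lin.
  by rewrite scale_tensr -scale_tensl; congr (_ \ot _); exact: mulr1.
have b : bilin (fun (c : k^o) (z : H) => (c : k) *: z) by lin.
have := congr1 (tlift (fun (c : k^o) (z : H) => (c : k) *: z)) (h a).
rewrite /= /unit_coact /twist_coact tliftE // => ->.
rewrite tlift_tlift; last lin.
rewrite tlift_tlift; last lin.
apply: eq_tlift => a0 a1; rewrite tliftE; last lin.
by rewrite tliftE.
Qed.

(** Expand the coinvariance identity at x_0 a and multiply it on the left by
    S(x_1): the S^2 of the middle component of x cancels, since
    S(x_2) S^2(x_1) = S(S(x_1) x_2). *)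
Lemma twist_coinvariant_transpose lam x a : twist_coinvariant lam ->
  \sw_(a0, a1 <- rA a) ((lam (x * a0) : k) *: S (S a1))
  = \sw_(x0, x1 <- rA x) ((lam (x0 * a) : k) *: S x1).
Proof.
move=> h; symmetry.
transitivity (\sw_(x', x2 <- rA x) \sw_(x0, x1 <- rA x') \sw_(a0, a1 <- rA a)
  ((lam (x0 * a0) : k) *: (S x2 * (S (S x1) * S (S a1))))).
  apply: eq_tlift => x' x2.
  rewrite -[S x2 in LHS]mulr1 scalerAr -h ca_mul /tmul tlift_tlift; last lin.
  rewrite tlift_mulr; apply: eq_tlift => x0 x1.
  rewrite tlift_tlift; last lin.
  rewrite tlift_mulr; apply: eq_tlift => a0 a1.
  by rewrite tliftE; [rewrite !antipodeM -scalerAr|lin].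
rewrite (@comod_sw _ _ _ _ _ _ (fun (x0 : A) (x1 x2 : H) => \sw_(a0, a1 <- rA a)
  ((lam (x0 * a0) : k) *: (S x2 * (S (S x1) * S (S a1)))))); last trilin.
rewrite -(comod_swr (F := fun x : A => \sw_(a0, a1 <- rA a)
  ((lam (x * a0) : k) *: S (S a1))) rA x); last lin.
apply: eq_tlift => x0 x'; rewrite tlift_exch tlift_scaler.
apply: eq_tlift => a0 a1; rewrite -tlift_scaler.
transitivity ((lam (x0 * a0) : k) *:
  (S (\sw_(x1, x2 <- D x') (S x1 * x2)) * S (S a1))).
  congr (_ *: _); rewrite tlift_lin tlift_mull; apply: eq_tlift => x1 x2.
  by rewrite antipodeM mulrA.
by rewrite antipodel linearZ /= antipode1 -scalerAl mul1r !scalerA mulrC.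
Qed.

Definition frob_map lam a : 'Hom(A, k^o) := dual_act a (linfun lam).

Lemma frob_mapE lam a x : frob_map lam a x = lam (x * a).
Proof. by rewrite dual_actE lfunE. Qed.

Fact frob_map_linear lam : linear (frob_map lam).
Proof. exact: (dual_act_bilin A).1. Qed.
HB.instance Definition _ lam :=
  GRing.isLinear.Build k A 'Hom(A, k^o) *:%R (frob_map lam)
    (frob_map_linear lam).

(** [twist_coinvariant_transpose], read off after evaluation at an arbitrary x:
    its right-hand side is the coaction of A^*. *)
Lemma frob_map_dh_hom lam : twist_coinvariant lam ->
  dh_hom (dh_regular (twist rA)) (dual_doiHopf rA) (frob_map lam).
Proof.
move=> h; split=> [r m|a /=]; first exact: dual_actM.
symmetry; apply: dual_coact_unique => x.
rewrite (tlift_comp _ _ (islin_dual_eval x)) /twist_coact.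
have b : bilin (fun a' h => dual_eval x (frob_map lam a' \ot h)).
  split=> z c u v; rewrite !dual_evalE.
    by rewrite linearP add_lfunE scale_lfunE scalerDl scalerA.
  by rewrite scalerDr !scalerA mulrC.
rewrite tlift_tlift //.
transitivity (\sw_(a0, a1 <- rA a) ((lam (x * a0) : k) *: S (S a1))).
  by apply: eq_tlift => a0 a1; rewrite tliftE // dual_evalE frob_mapE.
rewrite twist_coinvariant_transpose //.
by apply: eq_tlift => a0 a1; rewrite frob_mapE.
Qed.

(** An injective linear map between spaces of the same finite dimension. *)
Lemma left_faithful_frob_map_bij lam : left_faithful lam ->
  exists g : {linear 'Hom(A, k^o) -> A}, cancel (frob_map lam) g /\
    cancel g (frob_map lam).
Proof.
move=> lf; pose f := linfun (frob_map lam).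
have k0 : lker f == 0%VS.
  rewrite -subv0; apply/subvP => a; rewrite memv_ker memv0 lfunE /= => /eqP fa.
  by apply/eqP/lf => x; rewrite -frob_mapE fa zero_lfunE.
have gf : cancel f (f^-1)%VF by apply: lker0_lfunK.
have lf_full : limg f = fullv.
  apply/eqP; rewrite eqEdim subvf limg_dim_eq ?(eqP k0) ?capv0 //.
  by rewrite !dimvf /dim /= muln1.
exists (f^-1)%VF; split=> [a|g].
  by rewrite -[RHS]gf lfunE.
by have := @limg_lfunVK _ _ _ f g; rewrite lf_full memvf lfunE => ->.
Qed.

Definition has_frobenius_functional : Prop :=
  exists lam, twist_coinvariant lam /\ left_faithful lam.

(** The inverse of a bijective morphism is again a morphism. *)
Lemma frobenius_functional_left_Frobenius :
  has_frobenius_functional -> left_H_Frobenius rA.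
Proof.
move=> [lam [h lf]]; have [fr fc] := frob_map_dh_hom h.
have [g [fK gK]] := left_faithful_frob_map_bij lf.
exists (frob_map lam), g; split=> //; split=> [r m|m].
  apply: (can_inj fK); apply: (etrans (gK _)).
  by rewrite fr; congr dh_act; apply/esym/gK.
transitivity (\sw_(m0, m1 <- dual_doiHopf rA (frob_map lam (g m)))
  (g m0 \ot m1)).
  rewrite fc tlift_tlift; last lin.
  rewrite -[LHS]tlift_tens; apply: eq_tlift => a0 a1.
  rewrite tliftE; last lin.
  by congr (_ \ot _); apply/esym/fK.
by congr (tlift _ (dual_coact _ _)); apply: gK.
Qed.

(** * Associative forms and hyperplanes *)

Lemma hact_antipode2 (f : {scalar H}) a :
  hact rA (f \o S \o S) a = hact (twist rA) f a.
Proof.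
rewrite /hact /= /twist_coact tlift_tlift; last lin.
by apply: eq_tlift => a0 a1; rewrite tliftE; last lin.
Qed.

(** B(x, y) = f(y)(x) for an isomorphism f.  The identity relating B to the
    action of H^* is colinearity of f, evaluated at b and then at h. *)
Lemma left_Frobenius_form : left_H_Frobenius rA ->
  exists B : {biscalar A},
    [/\ nondegenerate_form B, associative_form B
      & forall (a b : A) (h : {scalar H}),
          B b (hact rA (h \o S \o S) a) = B (hact rA (h \o S) b) a].
Proof.
move=> [f [g [[fM fc] _ fK gK]]].
pose B0 x y : k := f y x.
have Bl : bilinear_for *%R *%R B0.
  by split=> ? a u v; rewrite /B0 linearP ?add_lfunE ?scale_lfunE.
pose Bt := bilinear_isBilinear.Build k A A k *%R *%R B0 Bl.
pose B : {biscalar A} := HB.pack B0 Bt.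
exists B; split.
- split=> [x Bx|y By].
    rewrite (coord_vbasis (memvf x)); apply: big1 => i _.
    have : f (g (dual_basis i)) x = 0 := Bx _.
    by rewrite gK lfunE /= => ->; rewrite scale0r.
  by rewrite -[y]fK -[RHS](linear0 g); congr (g _); apply/lfunP => x;
    rewrite zero_lfunE -(By x).
- move=> x y z; rewrite -[LHS]/(f z (x * y)) -[RHS]/(f (y * z) x).
  by rewrite (fM y z) dual_actE.
move=> a b h.
have hl : islin (fun z => (h z : k^o)) by lin.
transitivity (h (dual_eval b (\sw_(a0, a1 <- twist rA a) (f a0 \ot a1))) : k).
  rewrite -[LHS]/(f (hact rA (h \o S \o S) a) b) hact_antipode2 /hact.
  rewrite (tlift_comp (f := fun z => f z b)); last lin.
  rewrite (tlift_comp _ _ (islin_dual_eval b)) (tlift_comp _ _ hl).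
  apply: (@eq_tlift _ _ _ k^o) => a0 a1.
  by rewrite dual_evalE !linearZ /= scale_lfunE mulrC.
transitivity (h (dual_eval b (dual_coact rA (f a)))); first by rewrite -(fc a).
rewrite dual_coactE (tlift_comp _ _ hl) -[RHS]/(f a (hact rA (h \o S) b)) /hact.
rewrite (tlift_comp (f := fun z => f a z)); last lin.
by apply: (@eq_tlift _ _ _ k^o) => b0 b1; rewrite !linearZ /= mulrC.
Qed.

(** The hyperplane is the kernel of B(1, -).  It contains a left ideal I only if
    B(A, I) = B(1, A I) vanishes, and it contains (h S^2) . a when h(1) = 0
    because B(1, (h S^2) . a) = B((h S) . 1, a) = h(1) B(1, a). *)
Lemma form_hyperplane (B : {biscalar A}) :
    nondegenerate_form B -> associative_form B ->
    (forall (a b : A) (h : {scalar H}),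
          B b (hact rA (h \o S \o S) a) = B (hact rA (h \o S) b) a) ->
  exists P : {vspace A},
    [/\ hyperplane P,
        forall I : {vspace A}, left_ideal I -> (I <= P)%VS -> I = 0%VS
      & forall h : {scalar H}, h 1 = 0 ->
          forall a : A, hact rA (h \o S \o S) a \in P].
Proof.
move=> [B1 B2] BA BS.
have Bl : linear (B 1 : A -> k^o) by move=> c u v; rewrite linearP.
pose Bt := GRing.isLinear.Build k A k^o *:%R (B 1 : A -> k^o) Bl.
pose lam : {linear A -> k^o} := HB.pack (B 1 : A -> k^o) Bt.
pose P := lker (linfun lam).
have PE x : (x \in P) = (B 1 x == 0) by rewrite memv_ker lfunE.
have B1M x y : B 1 (x * y) = B x y by rewrite -BA mul1r.
exists P; split.
- rewrite /hyperplane -(limg_ker_dim (linfun lam) fullv) capfv addnC -add1n.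
  congr addn; apply/esym/eqP; rewrite eqn_leq; apply/andP; split.
    by apply: leq_trans (dimvS (subvf _)) _; rewrite dimvf.
  rewrite lt0n dimv_eq0 -subv0; apply/negP => /subvP lam0.
  have /eqP : (1 : A) = 0; last by rewrite oner_eq0.
  apply: B1 => x; have := lam0 _ (memv_img (linfun lam) (memvf x)).
  by rewrite lfunE memv0 => /eqP.
- move=> I Iid /subvP IP; apply/eqP; rewrite -subv0; apply/subvP => y Iy.
  rewrite memv0; apply/eqP/B2 => x; rewrite -B1M; apply/eqP; rewrite -PE.
  exact/IP/Iid.
move=> h h1 a; rewrite PE BS /hact ca_one /= tliftE; last lin.
by rewrite antipode1 h1 scale0r linear0l.
Qed.

(** The kernel of a comodule map f is a subcomodule because tensoring with H is
    exact.  Concretely, f f^-1 f = f makes a |-> a - f^-1 (f a) a projection onto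
    the kernel, and applying it to the left factor of the coaction of w does not
    change that coaction when f w = 0. *)
Lemma annihilator_subobject lam : twist_coinvariant lam ->
  dh_subobject (dh_regular (twist rA)) (lker (linfun (frob_map lam))).
Proof.
move=> lc; have [fM fc] := frob_map_dh_hom lc.
pose f := linfun (frob_map lam); rewrite -/f.
have fE a : f a = frob_map lam a by rewrite lfunE.
split=> [r w|w]; rewrite !memv_ker.
  rewrite !fE => /eqP fw; apply/eqP.
  transitivity (dual_act r (frob_map lam w)); first exact: fM r w.
  by rewrite fw; apply/lfunP => x; rewrite dual_actE !zero_lfunE.
rewrite fE => /eqP fw.
pose pr a := a - (f^-1)%VF (f a).
have prK a : pr a \in lker f.
  by rewrite memv_ker /pr linearB /= limg_lfunVK ?subrr // memv_img ?memvf.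
have pr_lin : islin (fun a => vsproj (lker f) (pr a)).
  move=> c u v; rewrite -linearP; congr (vsproj _ _).
  by rewrite /pr !(linearP f) !(linearP (f^-1)%VF) opprD addrACA scalerBr.
exists (\sw_(a0, a1 <- twist rA w) (vsproj (lker f) (pr a0) \ot a1)).
rewrite tlift_tlift; last lin.
transitivity (\sw_(a0, a1 <- twist rA w) (pr a0 \ot a1)); last first.
  apply: eq_tlift => a0 a1; rewrite tliftE; last lin.
  by rewrite vsprojK.
transitivity (\sw_(a0, a1 <- twist rA w) (a0 \ot a1)
    - \sw_(a0, a1 <- twist rA w) ((f^-1)%VF (f a0) \ot a1)); last first.
  rewrite /tlift -sumrB; apply: eq_bigr => -[a0 a1] _ /=.
  rewrite (islinD (f := fun z => z \ot a1)); last lin.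
  set u := (f^-1)%VF _; rewrite -[- u]scaleN1r scale_tensl.
  by rewrite scaleN1r.
rewrite tlift_tens -[LHS]subr0; congr (_ - _); symmetry.
transitivity (\sw_(g, h <- dual_coact rA (frob_map lam w)) ((f^-1)%VF g \ot h)).
  have -> : dual_coact rA (frob_map lam w) =
      \sw_(a0, a1 <- twist rA w) (f a0 \ot a1).
    by apply: etrans (fc w) _; apply: eq_tlift => a0 a1;
      rewrite fE.
  rewrite [RHS]tlift_tlift; last lin.
  by apply: eq_tlift => a0 a1; rewrite tliftE; last lin.
rewrite fw linear0.
apply: (islin0 (f := tlift (fun g h => (f^-1)%VF g \ot h))).
by apply: islin_tlift; lin.
Qed.

(** Any lam with kernel P works.  If sum lam(a_0) S^2(a_1) were not a multiple of
    1, some h with h(1) = 0 would not vanish on it, although (h S^2) . a is in P;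
    the scalar is then found by applying the counit. *)
Lemma hyperplane_frobenius_functional (P : {vspace A}) :
    hyperplane P ->
    (forall W : {vspace A},
        dh_subobject (dh_regular (twist rA)) W -> (W <= P)%VS -> W = 0%VS) ->
    (forall h : {scalar H}, h 1 = 0 ->
       forall a : A, hact rA (h \o S \o S) a \in P) ->
  has_frobenius_functional.
Proof.
move=> hP sub0 PS.
have [v nPv] : exists v, v \notin P.
  apply: contrapT => nex; have PT : P = fullv.
    apply/eqP; rewrite eqEsubv subvf; apply/subvP => x _.
    by apply: contraT => nPx; case: nex; exists x.
  by move: hP; rewrite /hyperplane PT => /eqP; rewrite eqn_leq ltnn.
have sP : subspace (fun x => x \in P).
  by split=> [|c x y Px Py]; rewrite ?mem0v // rpredD ?rpredZ.
have [l [lP lv]] := separating_functional sP (negP nPv).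
have ll : linear (l : A -> k^o) by move=> c x y; rewrite linearP.
pose lt := GRing.isLinear.Build k A k^o *:%R (l : A -> k^o) ll.
pose lam : {linear A -> k^o} := HB.pack (l : A -> k^o) lt.
have lamP x : lam x = 0 -> x \in P.
  move=> lx; have : x \in (P + <[v]>)%VS.
    suff -> : (P + <[v]>)%VS = fullv by rewrite memvf.
    apply/eqP; rewrite eqEdim subvf -hP -addn1 dimv_disjoint_sum.
      by rewrite dim_vline leq_add2l; case: eqP nPv => // ->; rewrite mem0v.
    apply/eqP; rewrite -subv0; apply/subvP => y; rewrite memv_cap.
    case/andP=> Py /vlineP[c yc]; move: (lP _ Py);
      rewrite yc linearZ /= lv mulr1.
    by move=> ->; rewrite scale0r mem0v.
  case/memv_addP=> p Pp [_ /vlineP[c ->] xE]; move: lx.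
  rewrite xE /= linearD linearZ /= (lP p Pp) lv add0r mulr1 => ->.
  by rewrite scale0r addr0.
have lc : twist_coinvariant lam.
  move=> a; pose z := \sw_(a0, a1 <- rA a) ((lam a0 : k) *: S (S a1)).
  have sk : subspace (fun z : H => exists c, z = c *: 1).
    split=> [|c x y [b ->] [b' ->]]; first by exists 0; rewrite scale0r.
    by exists (c * b + b'); rewrite scalerA scalerDl.
  have [c zc] : exists c, z = c *: 1.
    apply: contrapT => /(separating_functional sk)[h [h1 hz]].
    have /lP : hact rA (h \o S \o S) a \in P.
      by apply: PS; apply: h1; exists 1; rewrite scale1r.
    rewrite /hact (tlift_comp (f := fun x => (lam x : k^o))); last lin.
    move=> hz0; have /eqP := oner_neq0 k; apply; rewrite -[LHS]hz -[RHS]hz0.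
    rewrite /z (tlift_comp (f := fun x : H => (h x : k^o))); last lin.
    by apply: (@eq_tlift _ _ _ k^o) => a0 a1; rewrite !linearZ /= mulrC.
  rewrite -/z zc; congr (_ *: _).
  transitivity (counit hH z : k); first by rewrite zc linearZ /= counit1 mulr1.
  rewrite /z (tlift_comp (f := fun x : H => (eps x : k^o))); last lin.
  rewrite -[in RHS](coact1 rA a)
    (tlift_comp (f := fun x => (lam x : k^o))); last lin.
  apply: (@eq_tlift _ _ _ k^o) => a0 a1.
  by rewrite !linearZ /= !counit_antipode mulrC.
(* The annihilator lies in P because lam(a) = lam(1 a). *)
exists lam; split=> // a la; apply/eqP; rewrite -memv0.
rewrite -(sub0 _ (annihilator_subobject lc)).
  by rewrite memv_ker lfunE; apply/eqP/lfunP => x;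
    rewrite frob_mapE la zero_lfunE.
apply/subvP => x; rewrite memv_ker lfunE /= => /eqP fx; apply: lamP.
by rewrite -[x]mul1r -frob_mapE fx zero_lfunE.
Qed.

End LeftFrobenius.

(** * The Casimir element *)

Definition tens_assoc (k : fieldType) (U V W : lmodType k)
    (t : tensor (tensor U V) W) :
    tensor U (tensor V W) :=
  \sw_(s, w <- t) \sw_(u, v <- s) (u \ot (v \ot w)).

Lemma tens_assoc_inj (k : fieldType) (U V W : lmodType k) :
  injective (@tens_assoc k U V W).
Proof.
pose ainv (t : tensor U (tensor V W)) :=
  \sw_(u, s <- t) \sw_(v, w <- s) ((u \ot v) \ot w).
apply: (can_inj (g := ainv)); rewrite /ainv /tens_assoc.
apply: tensor_ext; [lin|lin|] => s w.
rewrite tliftE; last lin.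
move: s; apply: tensor_ext; [lin|lin|] => u v.
rewrite tliftE; last lin.
rewrite tliftE; last lin.
by rewrite tliftE; last lin.
Qed.

Section Casimir.
Variables (k : fieldType) (H : algType k) (hH : hopfAlg H).
Variables (A : falgType k) (rA : comodAlg hH A).
Local Notation D := (comul hH).
Local Notation S := (antipode hH).
Implicit Types (a b x y : A).

Variable lam : {linear A -> k^o}.
Hypothesis lam_coinv : twist_coinvariant rA lam.
Variable g : {linear 'Hom(A, k^o) -> A}.
Hypothesis frobK : cancel (frob_map lam) g.
Hypothesis gK : cancel g (frob_map lam).
Local Notation e := (vbasis {:A}).

Definition frob_eval (W : lmodType k) y (t : tensor A W) : W :=
  \sw_(u, w <- t) ((lam (y * u) : k) *: w).

Lemma islin_frob_eval (W : lmodType k) y : islin (@frob_eval W y).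
Proof. by rewrite /frob_eval; lin. Qed.

Lemma frob_evalE (W : lmodType k) y u (w : W) :
  frob_eval y (u \ot w) = (lam (y * u) : k) *: w.
Proof. by rewrite /frob_eval tliftE; last lin. Qed.

Lemma frob_expand u :
  u = \sum_(i < \dim {:A}) (lam (e`_i * u) : k) *: g (dual_basis i).
Proof.
rewrite -[LHS]frobK (dual_basis_expand (frob_map lam u)) linear_sum.
by apply: eq_bigr => i _; rewrite linearZ frob_mapE.
Qed.

Lemma frob_tensor_expand (W : lmodType k) (t : tensor A W) :
  t = \sum_(i < \dim {:A}) g (dual_basis i) \ot frob_eval e`_i t.
Proof.
move: t; apply: tensor_ext => [//||u w].
  move=> a u v; rewrite scaler_sumr -big_split; apply: eq_bigr => i _ /=.
  by rewrite (islin_frob_eval _) (bilin_tens _ _).2.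
rewrite {1}(frob_expand u) (islin_sum (f := fun z => z \ot w)); last lin.
by apply: eq_bigr => i _; rewrite frob_evalE scale_tensl scale_tensr.
Qed.

(** The functionals lam(y -) span A^*. *)
Lemma frob_tensor_ext (W : lmodType k) (s t : tensor A W) :
  (forall y, frob_eval y s = frob_eval y t) -> s = t.
Proof.
move=> h; rewrite (frob_tensor_expand s) (frob_tensor_expand t).
by apply: eq_bigr => i _; rewrite h.
Qed.

(** The basis of A together with its dual basis with respect to the form
    lam(x y), obtained from the coordinate functionals by inverting a |-> lam(- a). *)
Definition casimir : tensor A A :=
  \sum_(i < \dim {:A}) g (dual_basis i) \ot e`_i.

Lemma frob_eval_casimir y : frob_eval y casimir = y.
Proof.
rewrite [RHS](coord_vbasis (memvf y)) (islin_sum _ _ (islin_frob_eval y)).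
apply: eq_bigr => i _; rewrite frob_evalE -frob_mapE; congr (_ *: _).
have -> : frob_map lam (g (dual_basis i)) = dual_basis i by apply: gK.
by rewrite lfunE.
Qed.

Definition lact a (t : tensor A A) : tensor A A :=
  \sw_(x, y <- t) ((a * x) \ot y).
Definition ract (t : tensor A A) a : tensor A A :=
  \sw_(x, y <- t) (x \ot (y * a)).

(** Under lam(z -) on the left factor, both sides become z a. *)
Lemma casimir_comm a : lact a casimir = ract casimir a.
Proof.
apply: frob_tensor_ext => z.
rewrite !(tlift_comp _ _ (islin_frob_eval z)).
transitivity (frob_eval (z * a) casimir).
  by apply: eq_tlift => x y; rewrite frob_evalE mulrA.
transitivity (frob_eval z casimir * a); first by rewrite !frob_eval_casimir.
by rewrite {1}/frob_eval tlift_mull; apply: eq_tlift => x y;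
  rewrite frob_evalE scalerAl.
Qed.

(** Under lam(y -) on the first factor the coaction of sum u (x) v becomes
    sum lam(y u_0) v_0 (x) S^2(u_1) S^2(v_1).  [twist_coinvariant_transpose]
    moves the coaction from u to y; summing over the dual bases then replaces
    lam(y_0 u) v by y_0, and S(y_2) S^2(y_1) collapses to the counit. *)
Lemma casimir_coinvariant :
  tensor_comodule (twist rA) (twist rA) casimir = casimir \ot 1.
Proof.
apply: tens_assoc_inj; apply: frob_tensor_ext => y.
transitivity (y \ot (1 : H)); last first.
  rewrite /tens_assoc tliftE; last lin.
  rewrite (tlift_comp _ _ (islin_frob_eval y)) -{1}(frob_eval_casimir y).
  rewrite {1}/frob_eval tlift_tensl; apply: eq_tlift => u v.
  by rewrite frob_evalE scale_tensl.
(* The coaction of v multiplied by S(z), linear in v: it lets the sum over the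
   dual bases be carried out before the coaction is taken. *)
pose L z v := \sw_(v0, v1 <- twist rA v) (v0 \ot (S z * v1)).
transitivity (\sw_(u, v <- casimir) \sw_(y0, y1 <- rA y)
    ((lam (y0 * u) : k) *: L y1 v)).
  rewrite /= /tensor_coact /tens_assoc tlift_tlift; last lin.
  rewrite (tlift_comp _ _ (islin_frob_eval y)); apply: eq_tlift => u v.
  transitivity (\sw_(v0, v1 <- twist rA v)
    (v0 \ot ((\sw_(u0, u1 <- rA u) ((lam (y * u0) : k) *: S (S u1))) * v1))).
    rewrite tlift_tlift; last lin.
    rewrite (tlift_comp _ _ (islin_frob_eval y)) /= {1}/twist_coact.
    have yl := @islin_frob_eval (tensor A H) y.
    rewrite tlift_tlift; last lin.
    transitivity (\sw_(v0, v1 <- twist rA v) \sw_(u0, u1 <- rA u)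
       ((lam (y * u0) : k) *: (v0 \ot (S (S u1) * v1)))).
      rewrite tlift_exch; apply: eq_tlift => u0 u1.
      rewrite tliftE; last lin.
      rewrite tlift_tlift; last lin.
      rewrite (tlift_comp _ _ (islin_frob_eval y)); apply: eq_tlift => v0 v1.
      rewrite tliftE; last lin.
      rewrite tliftE; last lin.
      by rewrite frob_evalE.
    apply: eq_tlift => v0 v1; rewrite tlift_mull tlift_tensr.
    by apply: eq_tlift => u0 u1; rewrite -scalerAl scale_tensr.
  rewrite twist_coinvariant_transpose //.
  transitivity (\sw_(v0, v1 <- twist rA v) \sw_(y0, y1 <- rA y)
       ((lam (y0 * u) : k) *: (v0 \ot (S y1 * v1)))).
    apply: eq_tlift => v0 v1; rewrite tlift_mull tlift_tensr.
    by apply: eq_tlift => u0 u1; rewrite -scalerAl scale_tensr.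
  by rewrite tlift_exch; apply: eq_tlift => y0 y1; rewrite /L tlift_scaler.
rewrite tlift_exch.
transitivity (\sw_(y', y2 <- rA y) \sw_(y0, y1 <- rA y')
  (y0 \ot (S y2 * S (S y1)))).
  apply: eq_tlift => y' y2.
  transitivity (L y2 y').
    rewrite -[in RHS](frob_eval_casimir y') /frob_eval.
    rewrite (tlift_comp (f := L y2)); last by rewrite /L; lin.
    apply: eq_tlift => u v; symmetry; apply: (islinZ (f := L y2)).
    by rewrite /L; lin.
  rewrite /L /= /twist_coact tlift_tlift; last lin.
  by apply: eq_tlift => v0 v1; rewrite tliftE; last lin.
rewrite (@comod_sw _ _ _ _ _ _
  (fun (y0 : A) (y1 y2 : H) => y0 \ot (S y2 * S (S y1)))); last trilin.
rewrite -(comod_swr (F := fun y : A => y \ot (1 : H)) rA y); last lin.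
apply: eq_tlift => y0 y'; rewrite -tlift_tensr.
rewrite -scale_tensr; congr (_ \ot _).
transitivity (S (\sw_(y1, y2 <- D y') (S y1 * y2))).
  by rewrite tlift_lin; apply: eq_tlift => y1 y2; rewrite antipodeM.
by rewrite antipodel linearZ /= antipode1.
Qed.

(** The tensor product of A^(S^2) with itself is a Doi-Hopf module under
    multiplication on the left factor. *)
Lemma tensor_coact_lact a t :
  tensor_coact (twist rA) (twist rA) (lact a t) =
  \sw_(a0, a1 <- twist rA a)
    \sw_(s, h <- tensor_coact (twist rA) (twist rA) t) (lact a0 s \ot (a1 * h)).
Proof.
have lactl b : islin (lact b) by rewrite /lact; lin.
move: t; apply: tensor_ext; rewrite /lact /tensor_coact; [lin|lin|] => x y.
rewrite (tliftE (f := fun x y => (a * x) \ot y)); last lin.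
rewrite tliftE; last lin.
rewrite ca_mul /tmul tlift_tlift; last lin.
apply: eq_tlift => a0 a1; rewrite tlift_tlift; last lin.
rewrite tliftE; last lin.
rewrite [RHS]tlift_tlift; last lin.
apply: eq_tlift => x0 x1.
rewrite tliftE; last lin.
rewrite [RHS]tlift_tlift; last lin.
apply: eq_tlift => y0 y1.
rewrite tliftE; last lin.
rewrite tliftE; last lin.
by rewrite mulrA.
Qed.

Definition comultiplication a : tensor A A := lact a casimir.

Fact comultiplication_linear : linear comultiplication.
Proof.
by have : islin comultiplication by
  rewrite /comultiplication /lact; lin. Qed.

(** By [casimir_comm] the comultiplication can be written with a acting on
    either factor.  Using the left form for one occurrence and the right form for
    the other gives coassociativity, both iterated comultiplications of a being
    sum a p (x) q x (x) y. *)
Lemma casimir_frobenius_in_comod : frobenius_in_comod (twist rA).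
Proof.
pose dt := GRing.isLinear.Build k A (tensor A A) *:%R comultiplication
  comultiplication_linear.
pose delta : {linear A -> tensor A A} := HB.pack comultiplication dt.
have dE a : delta a = \sw_(x, y <- casimir) ((a * x) \ot y) by [].
have dEr a : delta a = \sw_(x, y <- casimir) (x \ot (y * a)).
  by rewrite -/(ract _ _) -casimir_comm.
have dMl a b : delta (a * b) = \sw_(x, y <- delta b) ((a * x) \ot y).
  rewrite !dE tlift_tlift; last lin.
  by apply: eq_tlift => x y; rewrite tliftE ?mulrA //; lin.
have dMr a b : delta (a * b) = \sw_(x, y <- delta a) (x \ot (y * b)).
  rewrite !dEr tlift_tlift; last lin.
  by apply: eq_tlift => x y; rewrite tliftE ?mulrA //; lin.
exists delta, lam; split=> //.
- split=> a.
  + rewrite dE tlift_tlift; last lin.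
    rewrite tlift_tlift; last lin.
    transitivity (\sw_(x, y <- casimir) \sw_(p, q <- casimir)
      ((a * p) \ot ((q * x) \ot y))).
      apply: eq_tlift => x y; rewrite tliftE; last lin.
      rewrite dMl dEr tlift_tlift; last lin.
      rewrite tlift_tlift; last lin.
      apply: eq_tlift => p q; rewrite tliftE; last lin.
      by rewrite tliftE; last lin.
    rewrite tlift_exch; apply: eq_tlift => p q.
    rewrite tliftE; last lin.
    by rewrite dE tlift_tensr.
  + rewrite dE tlift_tlift; last lin.
    rewrite -[RHS](frob_eval_casimir a); apply: eq_tlift => x y.
    by rewrite tliftE; last lin.
  + rewrite dEr tlift_tlift; last lin.
    apply: (can_inj frobK); apply/lfunP => z; rewrite !frob_mapE.
    rewrite -{2}(frob_eval_casimir z) /frob_eval tlift_mull.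
    rewrite (tlift_comp (f := fun x => lam (z * x))); last lin.
    rewrite (tlift_comp (f := fun x => lam x)); last lin.
    apply: (@eq_tlift _ _ _ k^o) => x y; rewrite tliftE; last lin.
    by rewrite -scalerAr -scalerAl !linearZ; apply: mulrC.
- move=> a; rewrite -[LHS]/(tensor_coact _ _ (lact a casimir))
    tensor_coact_lact.
  apply: eq_tlift => a0 a1; rewrite [tensor_coact _ _ _]casimir_coinvariant.
  by rewrite tliftE ?mulr1 //; rewrite /lact; lin.
- exact/twist_coinvariantP.
Qed.

End Casimir.

(** * Frobenius algebras among comodules *)

Lemma frobenius_functional_comod (k : fieldType) (H : algType k)
    (hH : hopfAlg H) (A : falgType k) (rA : comodAlg hH A) :
  has_frobenius_functional rA -> frobenius_in_comod (twist rA).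
Proof.
move=> [lam [lc /left_faithful_frob_map_bij[g [fK gK]]]].
exact: (casimir_frobenius_in_comod lc fK gK).
Qed.

(** If lam(x a) = 0 for all x, then a vanishes: by right linearity the
    comultiplication of a = 1 a is sum x (x) y a, so the counit axiom reads
    a = sum lam(y a) x. *)
Lemma comod_frobenius_functional (k : fieldType) (H : algType k)
    (hH : hopfAlg H) (A : falgType k) (rA : comodAlg hH A) :
  frobenius_in_comod (twist rA) -> has_frobenius_functional rA.
Proof.
move=> [delta [epsR [[_ _ cr] _ ec _ dr]]].
exists epsR; split; first exact/twist_coinvariantP.
move=> a ea; rewrite -[a]cr -[in delta a](mul1r a) dr tlift_tlift; last lin.
transitivity (\sw_(x, y <- delta 1) (0 : A)); last by rewrite /tlift big1.
apply: eq_tlift => x y; rewrite tliftE; last lin.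
by rewrite ea scale0r.
Qed.

Theorem theorem2p3 (k : fieldType) (H : algType k) (hH : hopfAlg H)
    (A : falgType k) (rA : comodAlg hH A) :
  [<-> left_H_Frobenius rA;
       exists B : {biscalar A},
         [/\ nondegenerate_form B, associative_form B
           & forall (a b : A) (f : {scalar H}),
               B b (hact rA (f \o antipode hH \o antipode hH) a)
               = B (hact rA (f \o antipode hH) b) a];
       exists P : {vspace A},
         [/\ hyperplane P,
             forall I : {vspace A}, left_ideal I -> (I <= P)%VS -> I = 0%VS
           & forall f : {scalar H}, f 1 = 0 ->
               forall a : A, hact rA (f \o antipode hH \o antipode hH) a \in P];
       exists P : {vspace A},
         [/\ hyperplane P,
             forall W : {vspace A},
               dh_subobject (dh_regular (twist rA)) W -> (W <= P)%VS -> W = 0%VS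
           & forall f : {scalar H}, f 1 = 0 ->
               forall a : A, hact rA (f \o antipode hH \o antipode hH) a \in P];
       frobenius_in_comod (twist rA)].
Proof.
tfae.
- exact: left_Frobenius_form.
- by move=> [B [Bnd BA BS]]; apply: (form_hyperplane Bnd BA BS).
- move=> [P [hP idl PS]]; exists P; split=> // W [Wm _].
  exact: idl.
- move=> [P [hP sub0 PS]].
  exact/frobenius_functional_comod/(hyperplane_frobenius_functional hP sub0 PS).
- by move/comod_frobenius_functional/frobenius_functional_left_Frobenius.
Qed.
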